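(* Let $\hat r=\tfrac12(\mathcal P_+-\mathcal P_-)+\hat r^0\mathcal P_0\in \mathrm{End}(L\mathfrak{gl}_n)$, where $\hat r^0\in \mathrm{End}(L\mathfrak h_n)$ is skew-symmetric and $\hat r\circ\hat h=\hat h\circ\hat r$, and put $\hat r_\pm=\hat r\pm\tfrac12\,\mathrm{id}$. The Poisson bracket on $L\mathfrak{gl}_n$ $$\{\hat\varphi,\hat\psi\}=\left\langle\left\langle\begin{pmatrix}\hat r&-\hat h\hat r_+\\ \hat r_-\hat h^{-1}&-\hat r\end{pmatrix}\begin{pmatrix}\nabla\hat\varphi\\ \nabla'\hat\varphi\end{pmatrix},\begin{pmatrix}\nabla\hat\psi\\ \nabla'\hat\psi\end{pmatrix}\right\rangle\right\rangle$$ admits the $q$-deformed Drinfeld-Sokolov reduction if and only if the operator $\hat r^0$ has the form $$\hat r^0=\frac12\,\frac{1+\hat h\hat\tau_n}{1-\hat h\hat\tau_n}\,\mathcal P_0'+\Delta\,\mathcal P_{U_n}+\hat\alpha-\hat\alpha^*,$$ where $\mathcal P_{U_n}$ is the orthogonal projection operator onto $U_n$, $\Delta$ is a skew-symmetric operator in $U_n$, and $\hat\alpha$ is a linear operator of the form $\hat\alpha(f)=\langle f,\alpha\rangle\cdot 1\in L\mathfrak h_n$ with $\alpha\in U_n^\perp$.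
   Context: Fix $q\in\mathbb C$, $0<|q|<1$. $\mathbb C((z^{-1}))$ is the field of formal series $a=\sum_{i\le N}a_iz^i$; $(\hat ha)(z)=a(qz)$, also written ${}^ha$; $\int a(z)\,dz/z:=a_0$. $\hat h$ acts on matrices entrywise. $L\mathfrak{gl}_n$ is the algebra of $n\times n$ matrices over $\mathbb C((z^{-1}))$ with inner product $\langle A,B\rangle=\int\frac{dz}{z}\mathrm{Tr}\,A(z)B(z)$. $L\mathfrak n_+(n)$, $L\mathfrak n_-(n)$, $L\mathfrak h_n$ are its subalgebras of strictly upper triangular, strictly lower triangular and diagonal matrices; $\mathcal P_+,\mathcal P_-,\mathcal P_0$ are the projections onto them in the decomposition $L\mathfrak{gl}_n=L\mathfrak n_+(n)\oplus L\mathfrak h_n\oplus L\mathfrak n_-(n)$; $L\mathfrak b_+(n)=L\mathfrak n_+(n)\oplus L\mathfrak h_n$. $L\mathbf N_+(n)$ is the group of upper triangular matrices over $\mathbb C((z^{-1}))$ with unit diagonal. $\mathcal P_{00}$ is the orthogonal projection onto $\mathbb C\cdot 1\subset L\mathfrak h_n$ (constant multiples of the unit matrix), $\mathcal P_0'=\mathcal P_0-\mathcal P_{00}$, $L\mathfrak h_n'=\mathcal P_0'(L\mathfrak h_n)$. Skew-symmetry, adjoints and orthogonality are with respect to $\langle\cdot,\cdot\rangle$ (an operator $T$ is skew-symmetric if $\langle Tf,g\rangle=-\langle f,Tg\rangle$). $\hat\tau_n\,\mathrm{diag}(f_0,f_1,\dots,f_{n-1})=\mathrm{diag}(f_1,\dots,f_{n-1},f_0)$.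 The operator $1-\hat h\hat\tau_n$ on $L\mathfrak h_n$ has kernel $\mathbb C\cdot1$ and image $L\mathfrak h_n'$, hence is invertible on $L\mathfrak h'_n$; $\frac{1+\hat h\hat\tau_n}{1-\hat h\hat\tau_n}\mathcal P_0'$ means $(1+\hat h\hat\tau_n)(1-\hat h\hat\tau_n)^{-1}\mathcal P_0'$ with this inverse. $U_n=\{\mathrm{diag}(f_0(z),f_0(q^{-1}z),\dots,f_0(q^{-(n-1)}z)):f_0\in\mathbb C((z^{-1}))\}$, and $U_n^\perp$ is its orthogonal complement in $L\mathfrak h_n$. A functional $\hat\varphi$ on $L\mathfrak{gl}_n$ is smooth if for every $\mathbb L$ there is $d\hat\varphi(\mathbb L)\in L\mathfrak{gl}_n$ with $\langle d\hat\varphi(\mathbb L),X\rangle=\frac{d}{dt}\big|_{t=0}\hat\varphi(\mathbb L+tX)$ for all $X$; $\nabla\hat\varphi(\mathbb L)=\mathbb L\,d\hat\varphi(\mathbb L)$, $\nabla'\hat\varphi(\mathbb L)=d\hat\varphi(\mathbb L)\,\mathbb L$. On a direct sum of two copies of a space with inner product, $\langle\langle(X_1,X_2)^T,(Y_1,Y_2)^T\rangle\rangle=\langle X_1,Y_1\rangle-\langle X_2,Y_2\rangle$. Gauge action of $L\mathbf N_+(n)$ on $L\mathfrak{gl}_n$: $\mathbb L\mapsto{}^hS\,\mathbb L\,S^{-1}$. $\Lambda_n$ is the matrix with ones on the first subdiagonal and zeros elsewhere, and $\mathbb Y_n=\{\Lambda_n+A: A\in L\mathfrak b_+(n)\}$,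 which is preserved by the gauge action. A Poisson bracket on $L\mathfrak{gl}_n$ is said to admit the $q$-deformed Drinfeld-Sokolov (DS) reduction if (1) the $L\mathbf N_+(n)$-invariant (smooth) functionals form a Lie subalgebra with respect to the bracket; and (2) the constraints defining $\mathbb Y_n$ generate a Poisson ideal in it, i.e. for every $L\mathbf N_+(n)$-invariant $\hat\psi$ which is constant on $\mathbb Y_n$ and every $L\mathbf N_+(n)$-invariant $\hat\varphi$, the bracket $\{\hat\varphi,\hat\psi\}$ vanishes on $\mathbb Y_n$. (For $\hat r=\tfrac12(\mathcal P_+-\mathcal P_-)+\hat r^0\mathcal P_0$ with $\hat r^0\in\mathrm{End}(L\mathfrak h_n)$ skew-symmetric and $\hat r\circ\hat h=\hat h\circ\hat r$, condition (1) holds automatically.) *)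

(* Defs.v *)
From HB Require Import structures.
From mathcomp Require Import all_boot all_order all_algebra.
From mathcomp Require Import zify.
From mathcomp Require Import all_classical all_reals all_analysis.
From mathcomp.real_closed Require Export complex.

Set Implicit Arguments.
Unset Strict Implicit.
Unset Printing Implicit Defensive.

Import Order.TTheory GRing.Theory Num.Theory.
Import numFieldNormedType.Exports.

Local Open Scope classical_set_scope.
Local Open Scope ring_scope.

(* Formal series in z^-1: [lcoef a i] is the coefficient of z^i. *)
Record laurent (F : fieldType) := Laurent {
  lcoef : int -> F;
  lcoef_bounded : exists N : int, forall i, N < i -> lcoef i = 0 }.

Section LaurentRing.
Variable F : fieldType.
Implicit Types a b c : laurent F.

HB.instance Definition _ := gen_eqMixin (laurent F).
HB.instance Definition _ := gen_choiceMixin (laurent F).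

Lemma laurentP a b : lcoef a =1 lcoef b -> a = b.
Proof.
case: a b => [f fP] [g gP] /= /funext fg; move: fP gP; rewrite fg => fP gP.
by congr Laurent; exact: Prop_irrelevance.
Qed.

Fact lzero_bounded : exists N : int, forall i, N < i -> (0 : F) = 0.
Proof. by exists 0. Qed.
Definition lzero := Laurent lzero_bounded.

Fact lopp_bounded a : exists N : int, forall i, N < i -> - lcoef a i = 0.
Proof.
by have [N aN] := lcoef_bounded a; exists N => i /aN ->; rewrite oppr0.
Qed.
Definition lopp a := Laurent (lopp_bounded a).

Fact ladd_bounded a b :
  exists N : int, forall i, N < i -> lcoef a i + lcoef b i = 0.
Proof.
have [N aN] := lcoef_bounded a; have [M bM] := lcoef_bounded b.
exists (Order.max N M) => i; rewrite gt_max => /andP[/aN -> /bM ->].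
by rewrite addr0.
Qed.
Definition ladd a b := Laurent (ladd_bounded a b).

Fact laddA : associative ladd.
Proof. by move=> a b c; apply: laurentP => i /=; rewrite addrA. Qed.
Fact laddC : commutative ladd.
Proof. by move=> a b; apply: laurentP => i /=; rewrite addrC. Qed.
Fact ladd0 : left_id lzero ladd.
Proof. by move=> a; apply: laurentP => i /=; rewrite add0r. Qed.
Fact laddN : left_inverse lzero lopp ladd.
Proof. by move=> a; apply: laurentP => i /=; rewrite addNr. Qed.

HB.instance Definition _ :=
  GRing.isZmodule.Build (laurent F) laddA laddC ladd0 laddN.

Definition lconv (u v : int -> F) (k : int) : F :=
  \sum_(i \in [set: int]) (u i * v (k - i)).

(* Products are computed on truncations: [ltrunc N l u] is the polynomial in
   z^-1 made of the first l+1 coefficients of z^-N u(z). *)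
Definition ltrunc (N : int) (l : nat) (u : int -> F) : {poly F} :=
  \poly_(j < l.+1) u (N - j%:Z).

Lemma lconv_gt (N M : int) (u v : int -> F) k :
    (forall i, N < i -> u i = 0) -> (forall i, M < i -> v i = 0) ->
  N + M < k -> lconv u v k = 0.
Proof.
move=> uN vM k_gt; rewrite /lconv fsbig1// => i _.
have [/uN ->|iN] := ltP N i; first by rewrite mul0r.
by rewrite vM ?mulr0//; lia.
Qed.

Lemma lconv_trunc (N M : int) (u v : int -> F) (l m : nat) :
    (forall i, N < i -> u i = 0) -> (forall i, M < i -> v i = 0) -> (l <= m)%N ->
  lconv u v (N + M - l%:Z) = (ltrunc N m u * ltrunc M m v)`_l.
Proof.
move=> uN vM lm; rewrite coefM /lconv.
rewrite (fsbigE [seq N - j%:Z | j <- iota 0 l.+1])//; last 2 first.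
- by rewrite map_inj_uniq ?iota_uniq// => i j; lia.
- move=> i _ iNl; have [/uN ->|iN] := ltP N i; first by rewrite mul0r.
  rewrite vM ?mulr0// ltNge; apply: contra iNl => iM.
  apply/mapP; exists `|N - i|%N; last by lia.
  by rewrite mem_iota; lia.
rewrite big_map -{1}[l.+1]subn0 -/(index_iota 0 l.+1) big_mkord.
under eq_bigl do rewrite in_setT.
apply: eq_bigr => j _; rewrite !coef_poly.
have jl := ltn_ord j; rewrite ltnS in jl.
rewrite !ltnS (leq_trans jl lm) (leq_trans (leq_subr _ _) lm).
by congr (_ * v _); lia.
Qed.

Fact lmul_bounded a b :
  exists N : int, forall i, N < i -> lconv (lcoef a) (lcoef b) i = 0.
Proof.
have [N aN] := lcoef_bounded a; have [M bM] := lcoef_bounded b.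
by exists (N + M) => i; exact: lconv_gt.
Qed.
Definition lmul a b := Laurent (lmul_bounded a b).

Lemma coef_lmul_gt (N M : int) a b k :
    (forall i, N < i -> lcoef a i = 0) -> (forall i, M < i -> lcoef b i = 0) ->
  N + M < k -> lcoef (lmul a b) k = 0.
Proof. exact: lconv_gt. Qed.

Lemma coef_lmul (N M : int) a b (l m : nat) :
    (forall i, N < i -> lcoef a i = 0) -> (forall i, M < i -> lcoef b i = 0) ->
    (l <= m)%N ->
  lcoef (lmul a b) (N + M - l%:Z) =
  (ltrunc N m (lcoef a) * ltrunc M m (lcoef b))`_l.
Proof. exact: lconv_trunc. Qed.

Lemma laurent_le_split (N k : int) : N < k \/ exists l : nat, k = N - l%:Z.
Proof. by have [|kN] := ltP N k; [left|right; exists `|N - k|%N; lia]. Qed.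

Lemma coefM_trunc (p p' r r' : {poly F}) l :
    (forall j, (j <= l)%N -> p`_j = p'`_j) ->
    (forall j, (j <= l)%N -> r`_j = r'`_j) ->
  (p * r)`_l = (p' * r')`_l.
Proof.
move=> pp' rr'; rewrite !coefM; apply: eq_bigr => j _.
by rewrite pp' ?rr' ?leq_subr// -ltnS.
Qed.

Lemma ltrunc_lmul (N M : int) a b (l j : nat) :
    (forall i, N < i -> lcoef a i = 0) -> (forall i, M < i -> lcoef b i = 0) ->
    (j <= l)%N ->
  (ltrunc (N + M) l (lcoef (lmul a b)))`_j =
  (ltrunc N l (lcoef a) * ltrunc M l (lcoef b))`_j.
Proof.
by move=> aN bM jl; rewrite coef_poly ltnS jl (coef_lmul aN bM jl).
Qed.

Fact lmulC : commutative lmul.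
Proof.
move=> a b; have [N aN] := lcoef_bounded a; have [M bM] := lcoef_bounded b.
apply: laurentP => k; have [kNM|[l ->]] := laurent_le_split (N + M) k.
  by rewrite (coef_lmul_gt aN bM)// (coef_lmul_gt bM aN)// addrC.
by rewrite (coef_lmul aN bM (leqnn l)) [N + M]addrC (coef_lmul bM aN (leqnn l)) mulrC.
Qed.

Fact lmulA : associative lmul.
Proof.
move=> a b c; have [N aN] := lcoef_bounded a; have [M bM] := lcoef_bounded b.
have [P cP] := lcoef_bounded c.
have abNM i : N + M < i -> lcoef (lmul a b) i = 0 by exact: coef_lmul_gt.
have bcMP i : M + P < i -> lcoef (lmul b c) i = 0 by exact: coef_lmul_gt.
apply: laurentP => k; have [kP|[l ->]] := laurent_le_split (N + M + P) k.
  by rewrite (coef_lmul_gt abNM cP)// (coef_lmul_gt aN bcMP)// addrA.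
rewrite (coef_lmul abNM cP (leqnn l)) -[N + M + P]addrA (coef_lmul aN bcMP (leqnn l)).
set pa := ltrunc N l (lcoef a); set pb := ltrunc M l (lcoef b).
set pc := ltrunc P l (lcoef c).
rewrite (@coefM_trunc _ pa _ (pb * pc))//; last first.
  by move=> j; exact: ltrunc_lmul.
rewrite mulrA; apply/esym; apply: coefM_trunc => // j; exact: ltrunc_lmul.
Qed.

Fact lconst_bounded (x : F) :
  exists N : int, forall i, N < i -> (if i == 0 then x else 0) = 0.
Proof. by exists 0 => i i0; rewrite gt_eqF. Qed.
(* the constant series x *)
Definition lconst (x : F) := Laurent (lconst_bounded x).

Fact lmul1 : left_id (lconst 1) lmul.
Proof.
move=> a; apply: laurentP => k; rewrite /= /lconv.
rewrite (fsbigE [:: 0])//=; last first.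
  by move=> i _; rewrite inE => /negPf ->; rewrite mul0r.
by rewrite big_mkcond big_seq1 in_setT mul1r subr0.
Qed.

Lemma lcoefD a b i : lcoef (a + b) i = lcoef a i + lcoef b i.
Proof. by []. Qed.

Fact lmulDl : left_distributive lmul +%R.
Proof.
move=> a b c; have [N1 aN] := lcoef_bounded a; have [N2 bN] := lcoef_bounded b.
have [P cP] := lcoef_bounded c; set N := Order.max N1 N2.
have {}aN i : N < i -> lcoef a i = 0 by rewrite gt_max => /andP[/aN].
have {}bN i : N < i -> lcoef b i = 0 by rewrite gt_max => /andP[_ /bN].
have abN i : N < i -> lcoef (a + b) i = 0.
  by move=> iN; rewrite lcoefD aN ?bN ?addr0.
apply: laurentP => k; rewrite lcoefD.
have [kP|[l ->]] := laurent_le_split (N + P) k.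
  by rewrite (coef_lmul_gt abN cP)// (coef_lmul_gt aN cP)//
             (coef_lmul_gt bN cP)// addr0.
rewrite (coef_lmul abN cP (leqnn l)) (coef_lmul aN cP (leqnn l)).
rewrite (coef_lmul bN cP (leqnn l)) -coefD -mulrDl.
apply: coefM_trunc => // j jl.
by rewrite coefD !coef_poly ltnS jl lcoefD.
Qed.

Fact lone_neq0 : lconst 1 != 0.
Proof.
apply/eqP => /(congr1 (fun a => lcoef a 0)) /eqP.
by rewrite /= oner_eq0.
Qed.

HB.instance Definition _ :=
  GRing.Zmodule_isComNzRing.Build (laurent F) lmulA lmulC lmul1 lmulDl lone_neq0.

Lemma laurent_top a : a != 0 ->
  exists2 N : int, lcoef a N != 0 & forall i, N < i -> lcoef a i = 0.
Proof.
move=> a0; have [M aM] := lcoef_bounded a.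
have ex : exists m : nat, lcoef a (M - m%:Z) != 0.
  apply: contrapT => nex; case/eqP: a0; apply: laurentP => k.
  have [/aM//|[l ->]] := laurent_le_split M k.
  by apply/eqP; apply: contrapT => /negP h; apply: nex; exists l.
have [m am min_m] := ex_minnP ex; exists (M - m%:Z) => // i mi.
have [/aM//|[l il]] := laurent_le_split M i; rewrite il.
by apply/eqP; apply: contraLR mi => /min_m; rewrite il; lia.
Qed.

Fixpoint linv_seq (u : nat -> F) (l : nat) : seq F :=
  if l is m.+1 then
    let s := linv_seq u m in
    rcons s ((u 0%N)^-1 * ((m == 0%N)%:R - \sum_(j < m) u (m - j)%N * s`_j))
  else [::].

Lemma size_linv_seq u l : size (linv_seq u l) = l.
Proof. by elim: l => //= l IH; rewrite size_rcons IH. Qed.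

Lemma nth_linv_seq u l m : (m < l)%N ->
  (linv_seq u l)`_m = (linv_seq u m.+1)`_m.
Proof.
elim: l => // l IH; rewrite ltnS leq_eqVlt => /predU1P[->//|ml].
by rewrite [LHS]/= nth_rcons size_linv_seq ml IH.
Qed.

Lemma linv_seqP u m : u 0%N != 0 ->
  \sum_(j < m.+1) u (m - j)%N * (linv_seq u j.+1)`_j = (m == 0%N)%:R.
Proof.
move=> u0; rewrite big_ord_recr [X in X + _ = _]/=.
under eq_bigr => j _ do rewrite -[rcons _ _]/(linv_seq u j.+1) -(@nth_linv_seq u m)//.
rewrite /= subnn nth_rcons size_linv_seq ltnn eqxx.
by rewrite mulVKf// addrC subrK.
Qed.

Lemma laurent_inv_ex a : a != 0 -> exists b, b * a = 1.
Proof.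
move=> /laurent_top[N aN0 aN]; set u := fun j : nat => lcoef a (N - j%:Z).
pose f (i : int) : F := if i <= - N then
  (linv_seq u (absz (- N - i)%R).+1)`_(absz (- N - i)%R) else 0.
have fP : forall i, - N < i -> f i = 0 by move=> i; rewrite ltNge /f => /negPf->.
have fb : exists M : int, forall i, M < i -> f i = 0 by exists (- N).
exists (Laurent fb); apply: laurentP => k; rewrite -[X in lcoef X]/(lmul _ _).
have [k0|[l ->]] := laurent_le_split (- N + N) k.
  rewrite (coef_lmul_gt (a := Laurent fb) fP aN)//=; move: k0; rewrite addNr.
  by move=> /gt_eqF ->.
rewrite (coef_lmul (a := Laurent fb) fP aN (leqnn l)) coefM.
have -> : lcoef (1 : laurent F) (- N + N - l%:Z) = (l == 0%N)%:R.
  by rewrite addNr sub0r; case: l.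
rewrite -(@linv_seqP u)//; last by rewrite /u subr0.
apply: eq_bigr => j _; rewrite !coef_poly ltn_ord ltnS leq_subr /= mulrC.
congr (_ * _); rewrite /f ifT; last by lia.
by have -> : absz (- N - (- N - j%:Z))%R = j :> nat by lia.
Qed.

Definition linv a : laurent F := xget 0 [set b | b * a = 1].

Fact lmulVf a : a != 0 -> linv a * a = 1.
Proof. by move=> /laurent_inv_ex[b ba]; exact: (@xgetI _ 0 [set c | c * a = 1] b ba). Qed.

Fact linv0 : linv 0 = 0.
Proof.
by rewrite /linv xgetPN// => b; rewrite /= mulr0 => /eqP; rewrite eq_sym oner_eq0.
Qed.

HB.instance Definition _ := GRing.ComNzRing_isField.Build (laurent F) lmulVf linv0.

End LaurentRing.

Section LoopAlgebra.
Variables (C : numFieldType) (n : nat).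

Local Notation Lgl := 'M[laurent C]_n.
(* A diagonal matrix is represented by the row vector of its entries. *)
Local Notation Lh := 'rV[laurent C]_n.
Implicit Types (q : C) (X Y L S : Lgl) (f g : Lh).

Definition residue (a : laurent C) : C := lcoef a 0.

Fact dilate_bounded q (a : laurent C) :
  exists N : int, forall i, N < i -> q ^ i * lcoef a i = 0.
Proof.
by have [N aN] := lcoef_bounded a; exists N => i /aN ->; rewrite mulr0.
Qed.
(* a(z) |-> a(q z) *)
Definition dilate q (a : laurent C) : laurent C := Laurent (dilate_bounded q a).

(* \hat h is [hop q] and its inverse is [hop q^-1]. *)
Definition hop q m (X : 'M[laurent C]_(m, n)) : 'M[laurent C]_(m, n) :=
  map_mx (dilate q) X.

Definition lscale m (c : C) (X : 'M[laurent C]_(m, n)) : 'M[laurent C]_(m, n) :=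
  lconst c *: X.

(* Loop matrices form a module over the field of series; the operators of the
   theory are linear over the constants only. *)
Definition clinear_on m (D : set 'M[laurent C]_(m, n))
    (T : 'M[laurent C]_(m, n) -> 'M[laurent C]_(m, n)) : Prop :=
  forall c u v, D u -> D v -> T (lscale c u + v) = lscale c (T u) + T v.

Definition pairing X Y : C := residue (\tr (X *m Y)).
Definition hpairing f g : C := pairing (diag_mx f) (diag_mx g).

Definition upper_part X : Lgl := \matrix_(i, j) if (i < j)%N then X i j else 0.
Definition lower_part X : Lgl := \matrix_(i, j) if (j < i)%N then X i j else 0.
Definition diag_part X : Lh := \row_i X i i.

Definition skew_on (D : set Lh) (T : Lh -> Lh) : Prop :=
  forall f g, D f -> D g -> hpairing (T f) g = - hpairing f (T g).

Definition orth_compl (U : set Lh) : set Lh :=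
  [set f | forall u, U u -> hpairing f u = 0].

(* The value is determined uniquely whenever the pairing is nondegenerate on U
   and f lies in the sum of U and its orthogonal complement. *)
Definition orth_proj (U : set Lh) f : Lh :=
  xget 0 [set g | U g /\ orth_compl U (f - g)].

Definition hadjoint (T : Lh -> Lh) g : Lh :=
  xget 0 [set w | forall f, hpairing (T f) g = hpairing f w].

Definition hconst (c : C) : Lh := const_mx (lconst c).

Definition P00 : Lh -> Lh := orth_proj (range hconst).
Definition P0' f : Lh := f - P00 f.

Definition tau f : Lh := \row_i f 0 (ordS i).
Definition htau q f : Lh := hop q (tau f).

(* inverse of 1 - htau on the image of P0' *)
Definition inv_1_sub_htau q g : Lh :=
  xget 0 [set w | range P0' w /\ w - htau q w = g].

Definition cayley_htau q f : Lh :=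
  let w := inv_1_sub_htau q (P0' f) in w + htau q w.

Definition Un q : set Lh :=
  range (fun f0 : laurent C => \row_i dilate (q ^- i) f0).

Definition rank1 (alpha f : Lh) : Lh := hconst (hpairing f alpha).

Definition rhat (r0 : Lh -> Lh) X : Lgl :=
  lscale 2^-1 (upper_part X - lower_part X) + diag_mx (r0 (diag_part X)).
Definition rhat_plus r0 X : Lgl := rhat r0 X + lscale 2^-1 X.
Definition rhat_minus r0 X : Lgl := rhat r0 X - lscale 2^-1 X.

(* The parameter t ranges over the complex scalars C. *)
Definition is_gradient (phi : Lgl -> C) L (D : Lgl) : Prop :=
  forall X, is_derive (0 : C^o) (1 : C^o)
    (fun t : C^o => phi (L + lscale t X) : C^o) (pairing D X).
Definition smooth (phi : Lgl -> C) : Prop :=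
  forall L, exists D, is_gradient phi L D.
Definition gradient (phi : Lgl -> C) L : Lgl :=
  xget 0 [set D | is_gradient phi L D].
Definition nabla (phi : Lgl -> C) L : Lgl := L *m gradient phi L.
Definition nabla' (phi : Lgl -> C) L : Lgl := gradient phi L *m L.

Definition pairing2 (X Y : Lgl * Lgl) : C :=
  pairing X.1 Y.1 - pairing X.2 Y.2.

Definition rmatrix q r0 (X : Lgl * Lgl) : Lgl * Lgl :=
  (rhat r0 X.1 - hop q (rhat_plus r0 X.2),
   rhat_minus r0 (hop q^-1 X.1) - rhat r0 X.2).

Definition qbracket q r0 (phi psi : Lgl -> C) : Lgl -> C := fun L =>
  pairing2 (rmatrix q r0 (nabla phi L, nabla' phi L)) (nabla psi L, nabla' psi L).

Definition unitriangular S : Prop :=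
  forall i j : 'I_n, (j <= i)%N -> S i j = (i == j)%:R.
Definition gauge q S L : Lgl := hop q S *m L *m invmx S.
Definition gauge_invariant q (phi : Lgl -> C) : Prop :=
  forall S L, unitriangular S -> phi (gauge q S L) = phi L.

Definition Lambda_n : Lgl := \matrix_(i, j) (nat_of_ord i == j.+1)%:R.
Definition upper_triangular X : Prop := forall i j : 'I_n, (j < i)%N -> X i j = 0.
Definition Yn : set Lgl :=
  [set L | exists2 A, upper_triangular A & L = Lambda_n + A].

(* The gauge-invariant functionals form a Lie subalgebra when the bracket, taken
   in the Lie algebra of functionals on L gl_n, of two of them is
   gauge-invariant. *)
Definition invariants_subalgebra q
    (br : (Lgl -> C) -> (Lgl -> C) -> (Lgl -> C)) : Prop :=
  forall phi psi, smooth phi -> gauge_invariant q phi ->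
    smooth psi -> gauge_invariant q psi -> gauge_invariant q (br phi psi).

Definition constraints_ideal q
    (br : (Lgl -> C) -> (Lgl -> C) -> (Lgl -> C)) : Prop :=
  forall phi psi, smooth phi -> gauge_invariant q phi ->
    smooth psi -> gauge_invariant q psi ->
    (exists c, forall L, Yn L -> psi L = c) ->
    forall L, Yn L -> br phi psi L = 0.

Definition admits_qDS_reduction q br : Prop :=
  invariants_subalgebra q br /\ constraints_ideal q br.

End LoopAlgebra.

(* Main.v *)
From HB Require Import structures.
Require Import Defs.
From mathcomp Require Import all_boot all_order all_fingroup all_algebra.
From mathcomp Require Import ring zify.
From mathcomp Require Import all_classical all_reals all_analysis.
From mathcomp.real_closed Require Import complex.

Set Implicit Arguments.
Unset Strict Implicit.
Unset Printing Implicit Defensive.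

Import Order.TTheory GRing.Theory Num.Theory.
Import numFieldNormedType.Exports.

Local Open Scope classical_set_scope.
Local Open Scope ring_scope.
Local Open Scope complex_scope.

(** Write T for the operator htau, and for a functional phi let its moment at L
    be h^-1 (nabla phi) - nabla' phi.

    Invariance under the gauge group says that phi (hS M) = phi (M S) for every
    unitriangular S and every M. For S = 1 + t Z both arguments are affine in t,
    so differentiating along lines is enough to see that the moment pairs to 0
    with every strictly upper triangular Z, that is, the moment is upper
    triangular (moment_upper). The parts of r outside the diagonal then drop out
    of the bracket of two invariants, which becomes
      <r0 x, y> + 1/2 (<h^-1 nabla phi, nabla' psi> - <nabla' phi, h^-1 nabla psi>)
    with x and y the diagonals of the moments (qbracket_invariant). Under a gauge
    transformation by S both h^-1 (nabla phi) and nabla' phi are conjugated by S,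
    so this is again invariant.

    If psi is moreover constant on Y_n, its gradient at a point of Y_n is strictly
    upper triangular, whence y = beta - T beta for a diagonal beta with first
    entry 0. Such y are orthogonal to U_n, and the bracket becomes
      - <x, r0 y - 1/2 (1 + T)/(1 - T) y>
    (qbracket_constraint). Put E = r0 - 1/2 (1 + T)/(1 - T) P0', the deviation; it
    is skew because T is an isometry. The diagonals x of moments are orthogonal to
    the constants. Hence the ideal property holds as soon as E maps the complement
    of U_n to the constants, which the announced form of r0 makes evident
    (constraints_ideal_qbracket).

    For the converse enough invariants are needed. Let L^(m) be the product of the
    dilations of L by q^(m-1), ..., q, 1, and let F_d (L) be the determinant with
    rows e_last L^(n-1-i) for i < d and e_i for i >= d. Then F_d is equal to 1 on
    Y_n, and it is semi-invariant under the action of all upper triangular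
    matrices: F_d (hS M) det S = chi_d (S) F_d (M S) with a character chi_d.
    Differentiating this identity at S = 1 + t u computes the moments of the
    functionals residue (a F_d) on Y_n (semi_invariant_moment): a diagonal u is
    orthogonal to all of them only if u is in U_n (flag_moments_perp). In the same
    way the functionals residue (a det), at a point with nonzero determinant, add
    the condition that the sum of the entries of u is fixed by the dilation, which
    leaves only the constants (det_moments_perp, Un_hconstP). So E maps the
    moments of the residue (a F_d) to constants and, being skew, maps the
    complement of the constants to U_n (deviation_Un). An operator with these
    properties is Delta P + alpha - alpha^*, with P the projection onto U_n
    (skew_Un_form). *)

(** * Series and their dilations *)

Arguments residue {C} a : simpl never.

Section Series.
Variable C : numFieldType.
Implicit Types (a b : laurent C) (c q : C).

Lemma lcoefB a b i : lcoef (a - b) i = lcoef a i - lcoef b i.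
Proof. by []. Qed.

Lemma lcoef_lconst_mul c a i : lcoef (lconst c * a) i = c * lcoef a i.
Proof.
rewrite [LHS]/(lconv _ _ _) /lconv (fsbigE [:: 0])//=; last first.
  by move=> j _; rewrite inE => /negPf ->; rewrite mul0r.
by rewrite big_mkcond big_seq1 in_setT subr0.
Qed.

Lemma lconst_inj : injective (@lconst C).
Proof. by move=> c d /(congr1 (fun a => lcoef a 0)). Qed.

Fact lconst_is_zmod_morphism : zmod_morphism (@lconst C).
Proof.
move=> c d; apply: laurentP => i.
by rewrite lcoefB /=; case: eqP => _; rewrite ?subrr.
Qed.
HB.instance Definition _ :=
  GRing.isZmodMorphism.Build C (laurent C) (@lconst C) lconst_is_zmod_morphism.

Fact lconst_is_monoid_morphism : monoid_morphism (@lconst C).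
Proof.
split=> // c d; apply: laurentP => i.
by rewrite lcoef_lconst_mul /=; case: eqP; rewrite ?mulr0.
Qed.
HB.instance Definition _ :=
  GRing.isMonoidMorphism.Build C (laurent C) (@lconst C)
    lconst_is_monoid_morphism.

Fact residue_is_zmod_morphism : zmod_morphism (@residue C).
Proof. by []. Qed.
HB.instance Definition _ :=
  GRing.isZmodMorphism.Build (laurent C) C (@residue C) residue_is_zmod_morphism.

Lemma residue_lconst_mul c a : residue (lconst c * a) = c * residue a.
Proof. exact: lcoef_lconst_mul. Qed.

(** The series form a field, so b can be the inverse of a. *)
Lemma residue_mul_eq0 a : (forall b, residue (b * a) = 0) -> a = 0.
Proof.
move=> a_perp; apply: contrapT => /eqP a_neq0; have := a_perp a^-1.
by rewrite mulVf// => /eqP; rewrite oner_eq0.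
Qed.

Fact dilate_is_zmod_morphism q : zmod_morphism (@dilate C q).
Proof. by move=> a b; apply: laurentP => i; rewrite lcoefB /= mulrBr. Qed.
HB.instance Definition _ q :=
  GRing.isZmodMorphism.Build (laurent C) (laurent C) (dilate q)
    (dilate_is_zmod_morphism q).

Lemma dilate_lconst q c : dilate q (lconst c) = lconst c.
Proof.
apply: laurentP => i /=.
by case: eqP => [->|]; rewrite ?expr0z ?mul1r ?mulr0.
Qed.

Lemma dilate1 q : dilate q 1 = 1.
Proof. exact: dilate_lconst. Qed.

Lemma dilate_nat q m : dilate q m%:R = m%:R.
Proof. by rewrite raddfMn /= dilate1. Qed.

Lemma residue_dilate q a : residue (dilate q a) = residue a.
Proof. by rewrite /residue /= expr0z mul1r. Qed.

Lemma dilateM q a b : q != 0 -> dilate q (a * b) = dilate q a * dilate q b.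
Proof.
move=> q_neq0; apply: laurentP => k.
transitivity (q ^ k * lconv (lcoef a) (lcoef b) k) => [//|].
rewrite [RHS]/(lconv _ _ _) /lconv mulr_fsumr.
apply: eq_fsbigr => i _ /=.
by rewrite mulrACA -expfzDr// [i + _]addrC subrK.
Qed.

Lemma dilate_comp q r a : dilate q (dilate r a) = dilate (q * r) a.
Proof. by apply: laurentP => k /=; rewrite mulrA expfzMl. Qed.

Lemma dilate_id a : dilate 1 a = a.
Proof. by apply: laurentP => k /=; rewrite exp1rz mul1r. Qed.

Lemma dilateK q : q != 0 -> cancel (dilate q) (@dilate C q^-1).
Proof. by move=> q0 a; rewrite dilate_comp mulVf// dilate_id. Qed.

Lemma dilateVK q : q != 0 -> cancel (@dilate C q^-1) (dilate q).
Proof. by move=> q0 a; rewrite dilate_comp mulfV// dilate_id. Qed.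

Lemma residue_dilateM q a b : q != 0 ->
  residue (a * dilate q b) = residue (dilate q^-1 a * b).
Proof.
by move=> q0; rewrite -{1}[a](dilateVK q0) -dilateM// residue_dilate.
Qed.

Section NotRootOfUnity.
Variable q : C.
Hypothesis q_inf : forall k : int, k != 0 -> q ^ k != 1.

(** The dilation multiplies the coefficient of z^k by q^k, which differs from 1
    unless k = 0. *)
Lemma dilate_fixed a : dilate q a = a -> a = lconst (residue a).
Proof.
move=> qa; apply: laurentP => k /=; case: eqP => [->//|/eqP k0].
have := congr1 (fun b => lcoef b k) qa => /= /eqP.
rewrite -subr_eq0 -{2}[lcoef a k]mul1r -mulrBl mulf_eq0 subr_eq0.
by rewrite (negPf (q_inf k0)) => /eqP.
Qed.

Lemma sub_dilate_surj m a : (0 < m)%N -> residue a = 0 ->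
  exists b, b - dilate (q ^+ m) b = a.
Proof.
move=> m_gt0 a0.
have bP : exists N : int, forall i, N < i ->
    (1 - (q ^+ m) ^ i)^-1 * lcoef a i = 0.
  by have [N aN] := lcoef_bounded a; exists N => i /aN ->; rewrite mulr0.
exists (Laurent bP); apply: laurentP => k; rewrite lcoefB /=.
rewrite -[X in X - _]mul1r -mulrBl mulrA.
have [->|k0] := eqVneq k 0; first by move: a0; rewrite /residue => ->; rewrite mulr0.
rewrite mulfV ?mul1r// subr_eq0 eq_sym -[q ^+ m]/(q ^ m%:Z) exprz_exp.
apply: q_inf; rewrite mulf_neq0//; lia.
Qed.
End NotRootOfUnity.

End Series.

(** * Loop matrices and their pairings *)

Section LoopMatrices.
Variables (C : numFieldType) (n : nat).
Implicit Types (q c t : C) (X Y Z L M S : 'M[laurent C]_n).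
Implicit Types (f g u v : 'rV[laurent C]_n).

Lemma lscaleDr m c (X Y : 'M[laurent C]_(m, n)) :
  lscale c (X + Y) = lscale c X + lscale c Y.
Proof. exact: scalerDr. Qed.

Lemma lscaleBr m c (X Y : 'M[laurent C]_(m, n)) :
  lscale c (X - Y) = lscale c X - lscale c Y.
Proof. exact: scalerBr. Qed.

Section Hop.
Variables (q : C) (q_neq0 : q != 0).

Lemma hopD m (X Y : 'M[laurent C]_(m, n)) : hop q (X + Y) = hop q X + hop q Y.
Proof. exact: map_mxD. Qed.

Lemma hopB m (X Y : 'M[laurent C]_(m, n)) : hop q (X - Y) = hop q X - hop q Y.
Proof. exact: map_mxB. Qed.

Lemma hopM X Y : hop q (X *m Y) = hop q X *m hop q Y.
Proof.
apply/matrixP => i j; rewrite !mxE raddf_sum; apply: eq_bigr => k _.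
by rewrite !mxE -dilateM.
Qed.

Lemma hopZ m c (X : 'M[laurent C]_(m, n)) :
  hop q (lscale c X) = lscale c (hop q X).
Proof. by apply/matrixP => i j; rewrite !mxE dilateM// dilate_lconst. Qed.

Lemma hop1 : hop q (1%:M : 'M[laurent C]_n) = 1%:M.
Proof. by apply/matrixP => i j; rewrite !mxE dilate_nat. Qed.

Lemma hopK m : cancel (@hop C n q m) (@hop C n q^-1 m).
Proof. by move=> X; apply/matrixP => i j; rewrite !mxE dilateK. Qed.

Lemma hopVK m : cancel (@hop C n q^-1 m) (@hop C n q m).
Proof. by move=> X; apply/matrixP => i j; rewrite !mxE dilateVK. Qed.

End Hop.

Lemma residue_mxtrace_hop q X : residue (\tr (hop q X)) = residue (\tr X).
Proof.
rewrite !raddf_sum; apply: eq_bigr => i _; rewrite !mxE; exact: residue_dilate.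
Qed.

Lemma pairingC X Y : pairing X Y = pairing Y X.
Proof. by rewrite /pairing mxtrace_mulC. Qed.

Lemma pairingDl X Y Z : pairing (X + Y) Z = pairing X Z + pairing Y Z.
Proof. by rewrite /pairing mulmxDl !raddfD. Qed.

Lemma pairingBl X Y Z : pairing (X - Y) Z = pairing X Z - pairing Y Z.
Proof. by rewrite /pairing mulmxBl !raddfB. Qed.

Lemma pairingBr X Y Z : pairing Z (X - Y) = pairing Z X - pairing Z Y.
Proof. by rewrite /pairing mulmxBr !raddfB. Qed.

Lemma pairingZl c X Z : pairing (lscale c X) Z = c * pairing X Z.
Proof. by rewrite /pairing -scalemxAl mxtraceZ residue_lconst_mul. Qed.

Lemma pairing_mulA X Y Z : pairing (X *m Y) Z = pairing X (Y *m Z).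
Proof. by rewrite /pairing mulmxA. Qed.

Lemma pairing_mulC X Y Z : pairing (X *m Y) Z = pairing Y (Z *m X).
Proof. by rewrite pairingC -pairing_mulA pairingC. Qed.

Lemma pairing_hop q X Y : q != 0 -> pairing (hop q X) (hop q Y) = pairing X Y.
Proof. by move=> q0; rewrite /pairing -hopM// residue_mxtrace_hop. Qed.

Lemma pairing_delta X a i j :
  pairing X (a *: delta_mx j i) = residue (a * X i j).
Proof.
rewrite /pairing -scalemxAr mxtraceZ; congr (residue (a * _)).
rewrite /mxtrace (bigD1 i)//= mxE (bigD1 j)//= !mxE !eqxx mulr1.
rewrite big1 ?addr0; last by move=> k kj; rewrite !mxE (negPf kj) mulr0.
rewrite big1 ?addr0// => k ki; rewrite mxE big1// => l _.
by rewrite !mxE (negPf ki) andbF mulr0.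
Qed.

Lemma pairing_eq0 X : (forall Y, pairing X Y = 0) -> X = 0.
Proof.
move=> X0; apply/matrixP => i j; rewrite mxE; apply: residue_mul_eq0 => a.
by rewrite -pairing_delta.
Qed.

Lemma hpairingE f g : hpairing f g = residue (\sum_i f 0 i * g 0 i).
Proof.
rewrite /hpairing /pairing mulmx_diag mxtrace_diag.
by congr residue; apply: eq_bigr => i _; rewrite mxE.
Qed.

Lemma pairing_diag X u : pairing X (diag_mx u) = hpairing (diag_part X) u.
Proof.
rewrite hpairingE /pairing; congr residue; apply: eq_bigr => i _.
by rewrite mul_mx_diag !mxE.
Qed.

Lemma hpairingC f g : hpairing f g = hpairing g f.
Proof. exact: pairingC. Qed.

Lemma hpairingDl f g u : hpairing (f + g) u = hpairing f u + hpairing g u.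
Proof. by rewrite /hpairing raddfD pairingDl. Qed.

Lemma hpairingBl f g u : hpairing (f - g) u = hpairing f u - hpairing g u.
Proof. by rewrite /hpairing raddfB pairingBl. Qed.

Lemma hpairingZl c f u : hpairing (lscale c f) u = c * hpairing f u.
Proof. by rewrite /hpairing /lscale linearZ pairingZl. Qed.

Lemma hpairingDr f g u : hpairing u (f + g) = hpairing u f + hpairing u g.
Proof. by rewrite hpairingC hpairingDl !(hpairingC u). Qed.

Lemma hpairingBr f g u : hpairing u (f - g) = hpairing u f - hpairing u g.
Proof. by rewrite hpairingC hpairingBl !(hpairingC u). Qed.

Lemma hpairingZr c f u : hpairing u (lscale c f) = c * hpairing u f.
Proof. by rewrite hpairingC hpairingZl (hpairingC u). Qed.

Lemma hpairing0l u : hpairing 0 u = 0.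
Proof. by rewrite -(subrr u) hpairingBl subrr. Qed.

Lemma hpairing_eq0 f : (forall g, hpairing f g = 0) -> f = 0.
Proof.
move=> f0; apply/rowP => i; rewrite mxE; apply: residue_mul_eq0 => a.
have := f0 (a *: delta_mx 0 i); rewrite hpairingE (bigD1 i)//= !mxE !eqxx.
rewrite mulr1 big1; last by move=> j ji; rewrite !mxE (negPf ji) !mulr0.
by rewrite addr0 [f 0 i * a]mulrC.
Qed.

Lemma hpairing_eq f g : (forall u, hpairing f u = hpairing g u) -> f = g.
Proof.
move=> fg; apply/eqP; rewrite -subr_eq0; apply/eqP/hpairing_eq0 => u.
by rewrite hpairingBl fg subrr.
Qed.

Lemma hpairing_hop q f g : q != 0 -> hpairing (hop q f) (hop q g) = hpairing f g.
Proof.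
move=> q0; rewrite !hpairingE !raddf_sum; apply: eq_bigr => i _ /=.
by rewrite !mxE -dilateM// residue_dilate.
Qed.

Lemma diag_partE X i : diag_part X 0 i = X i i.
Proof. by rewrite mxE. Qed.

Lemma diag_part_hopE q X i : diag_part (hop q X) 0 i = dilate q (X i i).
Proof. by rewrite !mxE. Qed.

Lemma diag_partB X Y : diag_part (X - Y) = diag_part X - diag_part Y.
Proof. by apply/rowP => i; rewrite !mxE. Qed.

Lemma pairing_upper X Y : upper_triangular X -> upper_triangular Y ->
  pairing X Y = hpairing (diag_part X) (diag_part Y).
Proof.
move=> Xu Yu; rewrite hpairingE /pairing; congr residue; apply: eq_bigr => i _.
rewrite mxE (bigD1 i)//= !mxE big1 ?addr0// => j ji.
have [lt_ij|lt_ji|/val_inj ij] := ltngtP i j; last by rewrite ij eqxx in ji.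
- by rewrite (Yu j i lt_ij) mulr0.
- by rewrite (Xu i j lt_ji) mul0r.
Qed.

Lemma upper_triangularD X Y :
  upper_triangular X -> upper_triangular Y -> upper_triangular (X + Y).
Proof. by move=> Xu Yu i j ji; rewrite mxE Xu ?Yu ?addr0. Qed.

Lemma upper_triangular_hop q X :
  upper_triangular X -> upper_triangular (hop q X).
Proof. by move=> Xu i j ji; rewrite mxE Xu ?raddf0. Qed.

Lemma diag_part_mul_upper X Y i : upper_triangular X -> upper_triangular Y ->
  diag_part (X *m Y) 0 i = X i i * Y i i.
Proof.
move=> Xu Yu; rewrite !mxE (bigD1 i)//= big1 ?addr0// => j ji.
have [lt_ij|lt_ji|/val_inj ij] := ltngtP i j; last by rewrite ij eqxx in ji.
- by rewrite (Yu j i lt_ij) mulr0.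
- by rewrite (Xu i j lt_ji) mul0r.
Qed.

Lemma det_upper X : upper_triangular X -> \det X = \prod_i X i i.
Proof.
move=> Xu; rewrite -det_tr det_trig; last first.
  by apply/is_trig_mxP => i j ij; rewrite mxE Xu.
by apply: eq_bigr => i _; rewrite mxE.
Qed.

Lemma unitriangular_upper S : unitriangular S -> upper_triangular S.
Proof. by move=> Su i j ji; rewrite Su ?(ltnW ji)// -val_eqE gtn_eqF. Qed.

Lemma unitriangular_diag S i : unitriangular S -> S i i = 1.
Proof. by move=> Su; rewrite Su// eqxx. Qed.

Lemma det_unitriangular S : unitriangular S -> \det S = 1.
Proof.
move=> Su; rewrite det_upper; last exact: unitriangular_upper.
by rewrite big1// => i _; exact: unitriangular_diag.
Qed.

Lemma unitriangular_unit S : unitriangular S -> S \in unitmx.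
Proof. by move=> Su; rewrite unitmxE det_unitriangular// unitr1. Qed.

Lemma unitriangular_hop q S : unitriangular S -> unitriangular (hop q S).
Proof. by move=> Su i j ji; rewrite mxE Su// dilate_nat. Qed.

Lemma hop_invmx q S : q != 0 -> unitriangular S ->
  hop q (invmx S) = invmx (hop q S).
Proof.
move=> q0 Su; have hSu := unitriangular_unit (unitriangular_hop q Su).
rewrite -[LHS](mulKmx hSu) -hopM// mulmxV ?unitriangular_unit// hop1.
by rewrite mulmx1.
Qed.

(** The relation between X and Y is conjugation by S, in a form without
    inverses. *)
Lemma diag_part_conj S X Y : unitriangular S ->
    upper_triangular X -> upper_triangular Y -> Y *m S = S *m X ->
  diag_part Y = diag_part X.
Proof.
move=> Su Xu Yu YS; have S_up := unitriangular_upper Su; apply/rowP => i.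
have := congr1 (fun Z => diag_part Z 0 i) YS.
by rewrite !diag_part_mul_upper// !(unitriangular_diag i Su) mulr1 mul1r !mxE.
Qed.

End LoopMatrices.

(** * Gradients, moments and the bracket of invariants *)

Section Gradients.
Variables (C : numFieldType) (n : nat).
Implicit Types (phi psi : 'M[laurent C]_n -> C) (L D X : 'M[laurent C]_n).

(** Comparing the two directional derivatives of one and the same function of
    the parameter replaces every use of a chain rule, which fails for
    functionals that are only differentiable along lines. *)
Lemma is_gradient_pairing phi psi L L' D D' X X' :
    is_gradient phi L D -> is_gradient psi L' D' ->
    (forall t, phi (L + lscale t X) = psi (L' + lscale t X')) ->
  pairing D X = pairing D' X'.
Proof.
move=> /(_ X) phiD /(_ X') psiD' /funext E.
have := @derive_val _ _ _ _ _ _ _ phiD; rewrite E.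
by have := @derive_val _ _ _ _ _ _ _ psiD' => -> ->.
Qed.

Lemma gradientE phi L D : is_gradient phi L D -> gradient phi L = D.
Proof.
move=> phiD; have phiG : is_gradient phi L (gradient phi L).
  exact: (@xgetI _ 0 [set D | is_gradient phi L D] D phiD).
apply/eqP; rewrite -subr_eq0; apply/eqP/pairing_eq0 => X.
by rewrite pairingBl (is_gradient_pairing phiG phiD (fun=> erefl)) subrr.
Qed.

Lemma gradientP phi L : smooth phi -> is_gradient phi L (gradient phi L).
Proof. by move=> /(_ L)[D phiD]; rewrite (gradientE phiD). Qed.

Lemma pairing_gradient_const phi L X c : smooth phi ->
  (forall t, phi (L + lscale t X) = c) -> pairing (gradient phi L) X = 0.
Proof.
move=> phi_smooth phi_c; have /(_ X) := gradientP L phi_smooth.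
rewrite (_ : (fun t : C^o => phi (L + lscale t X)) = cst c); last exact/funext.
move=> phiD; rewrite -(@derive_val _ _ _ _ _ _ _ phiD).
exact: derive_cst.
Qed.

End Gradients.

(** The momentum of the gauge action: pairing it with a matrix Z gives the
    derivative of the functional along the infinitesimal gauge field of Z. *)
Definition moment (C : numFieldType) (n : nat) (q : C)
    (phi : 'M[laurent C]_n -> C) (L : 'M[laurent C]_n) : 'M[laurent C]_n :=
  hop q^-1 (nabla phi L) - nabla' phi L.

Section Invariants.
Variables (C : numFieldType) (n : nat) (q : C).
Hypothesis q_neq0 : q != 0.
Implicit Types (phi psi : 'M[laurent C]_n -> C) (L D X Z S : 'M[laurent C]_n).

Lemma pairing_moment phi L Z :
  pairing (moment q phi L) Z =
  pairing (gradient phi L) (hop q Z *m L - L *m Z).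
Proof.
have qV0 : q^-1 != 0 by rewrite invr_eq0.
rewrite pairingBl pairingBr -{1}[Z](hopK q_neq0) pairing_hop//.
by rewrite pairing_mulC -pairing_mulA pairing_mulA [pairing (nabla' _ _) _]pairing_mulA.
Qed.

Lemma hpairing_moment phi L u :
  hpairing (diag_part (moment q phi L)) u =
  pairing (gradient phi L) (hop q (diag_mx u) *m L - L *m diag_mx u).
Proof. by rewrite -pairing_diag pairing_moment. Qed.

Lemma hpairing_moment_hconst phi L c :
  hpairing (diag_part (moment q phi L)) (hconst n c) = 0.
Proof.
rewrite hpairing_moment (_ : diag_mx (hconst n c) = (lconst c)%:M); last first.
  by apply/matrixP => i j; rewrite !mxE.
rewrite (_ : hop q _ = (lconst c)%:M); last first.
  by apply/matrixP => i j; rewrite !mxE raddfMn /= dilate_lconst.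
by rewrite scalar_mxC subrr pairingC /pairing mul0mx !raddf0.
Qed.

(** Invariance under S = 1 + t Z, applied to L S, equates the values of phi along
    the two lines L + t (hop q Z) L and L + t L Z. *)
Lemma moment_upper phi L : smooth phi -> gauge_invariant q phi ->
  upper_triangular (moment q phi L).
Proof.
move=> phi_smooth phi_inv i j lt_ji; apply: residue_mul_eq0 => a.
rewrite -pairing_delta pairing_moment; set Z := _ *: _.
rewrite pairingBr; apply/eqP; rewrite subr_eq0; apply/eqP.
have grad := gradientP L phi_smooth; apply: (is_gradient_pairing grad grad) => t.
pose S := 1%:M + lscale t Z.
have Su : unitriangular S.
  move=> k l lk; rewrite !mxE; case: (k =P j) => [kj|_]; last first.
    by rewrite andFb !mulr0 addr0.
  case: (l =P i) => [li|_]; last by rewrite andbF !mulr0 addr0.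
  by move: lk; rewrite kj li leqNgt lt_ji.
have := phi_inv S (L *m S) Su.
rewrite /gauge mulmxA (mulmxK (unitriangular_unit Su)).
rewrite /S hopD hop1 hopZ// mulmxDl mulmxDr mul1mx mulmx1 /lscale.
by rewrite -scalemxAl -scalemxAr.
Qed.

Lemma gradient_gauge phi S L : smooth phi -> gauge_invariant q phi ->
    unitriangular S ->
  gradient phi (gauge q S L) = S *m gradient phi L *m invmx (hop q S).
Proof.
move=> phi_smooth phi_inv Su; apply: gradientE => X.
have S_unit := unitriangular_unit Su.
have hS_unit := unitriangular_unit (unitriangular_hop q Su).
rewrite -mulmxA pairing_mulC pairing_mulA mulmxA.
rewrite (_ : (fun t : C^o => _) =
  (fun t : C^o => phi (L + lscale t (invmx (hop q S) *m X *m S)))).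
  exact: gradientP.
apply/funext => t; rewrite -[RHS](phi_inv S _ Su) /gauge; congr phi.
rewrite mulmxDr mulmxDl; congr (_ + _).
rewrite /lscale -scalemxAr -scalemxAl !mulmxA mulmxV// mul1mx.
by rewrite -mulmxA mulmxV// mulmx1.
Qed.

Lemma nabla_gauge phi S L : smooth phi -> gauge_invariant q phi ->
    unitriangular S ->
  hop q^-1 (nabla phi (gauge q S L)) =
  S *m hop q^-1 (nabla phi L) *m invmx S.
Proof.
move=> phi_smooth phi_inv Su.
have -> : nabla phi (gauge q S L) = hop q (S *m hop q^-1 (nabla phi L) *m invmx S).
  move: {-2}(nabla phi L) (erefl (nabla phi L)) => N NE.
  rewrite !hopM// hopVK// hop_invmx// NE /nabla gradient_gauge// /gauge -!mulmxA.
  by rewrite [invmx S *m _](mulKmx (unitriangular_unit Su)).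
by rewrite hopK.
Qed.

Lemma nabla'_gauge phi S L : smooth phi -> gauge_invariant q phi ->
    unitriangular S ->
  nabla' phi (gauge q S L) = S *m nabla' phi L *m invmx S.
Proof.
move=> phi_smooth phi_inv Su; rewrite /nabla' gradient_gauge// /gauge -!mulmxA.
by rewrite [invmx (hop q S) *m _](mulKmx (unitriangular_unit (unitriangular_hop q Su))).
Qed.

Lemma moment_gauge phi S L : smooth phi -> gauge_invariant q phi ->
    unitriangular S ->
  diag_part (moment q phi (gauge q S L)) = diag_part (moment q phi L).
Proof.
move=> phi_smooth phi_inv Su; apply: (diag_part_conj Su); try exact: moment_upper.
rewrite /moment nabla_gauge// nabla'_gauge// -mulmxBl -mulmxBr.
by rewrite (mulmxKV (unitriangular_unit Su)).
Qed.

Lemma pairing_conj S X Z : S \in unitmx ->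
  pairing (S *m X *m invmx S) (S *m Z *m invmx S) = pairing X Z.
Proof.
move=> S_unit; rewrite pairing_mulA -!mulmxA mulKmx//.
by rewrite pairing_mulC -!mulmxA mulVmx// mulmx1.
Qed.

Section Bracket.
Variable r0 : 'rV[laurent C]_n -> 'rV[laurent C]_n.
Hypothesis r0_linear : clinear_on setT r0.
Hypothesis r_hop : forall X, rhat r0 (hop q X) = hop q (rhat r0 X).

Lemma clinearB (r : 'rV[laurent C]_n -> 'rV[laurent C]_n) f g :
  clinear_on setT r -> r (f - g) = r f - r g.
Proof.
move=> r_lin; have := r_lin (-1) g f I I.
have scaleN1 h : lscale (-1) h = - h :> 'rV[laurent C]_n.
  by rewrite /lscale rmorphN1 scaleN1r.
by rewrite !scaleN1 addrC => ->; rewrite addrC.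
Qed.

Lemma rhatB X Z : rhat r0 (X - Z) = rhat r0 X - rhat r0 Z.
Proof.
rewrite /rhat diag_partB clinearB// raddfB /= opprD addrACA; congr (_ + _).
rewrite -lscaleBr; congr lscale; apply/matrixP => i j; rewrite !mxE.
by case: ltngtP => _; ring.
Qed.

Lemma diag_part_rhat X : diag_part (rhat r0 X) = r0 (diag_part X).
Proof.
by apply/rowP => i; rewrite !mxE !ltnn subr0 mulr0 add0r eqxx mulr1n.
Qed.

Lemma rhat_upper X : upper_triangular X -> upper_triangular (rhat r0 X).
Proof.
move=> Xu i j ji; rewrite !mxE ltnNge (ltnW ji) ji Xu// subr0 mulr0.
by rewrite -val_eqE gtn_eqF ?mulr0n ?addr0.
Qed.

Lemma pairing_rhat_upper X Z : upper_triangular X -> upper_triangular Z ->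
  pairing (rhat r0 X) Z = hpairing (r0 (diag_part X)) (diag_part Z).
Proof.
by move=> Xu Zu; rewrite (pairing_upper (rhat_upper Xu) Zu) diag_part_rhat.
Qed.

(** On invariant functionals the bracket only sees the diagonal part of r,
    because both moments are upper triangular. *)
Lemma qbracket_invariant phi psi L : smooth phi -> gauge_invariant q phi ->
    smooth psi -> gauge_invariant q psi ->
  qbracket q r0 phi psi L =
  hpairing (r0 (diag_part (moment q phi L))) (diag_part (moment q psi L)) +
  2^-1 * (pairing (hop q^-1 (nabla phi L)) (nabla' psi L) -
          pairing (nabla' phi L) (hop q^-1 (nabla psi L))).
Proof.
move=> phi_smooth phi_inv psi_smooth psi_inv.
rewrite -pairing_rhat_upper; try exact: moment_upper.
rewrite /qbracket /pairing2 /rmatrix /= /moment.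
have [a ->] : exists a, nabla phi L = hop q a.
  by exists (hop q^-1 (nabla phi L)); rewrite hopVK.
have [b ->] : exists b, nabla psi L = hop q b.
  by exists (hop q^-1 (nabla psi L)); rewrite hopVK.
rewrite r_hop -hopB pairing_hop// !hopK// /rhat_plus /rhat_minus.
rewrite rhatB !(pairingBl, pairingBr, pairingDl) !pairingZl.
do 6! move: (pairing _ _) => ?; ring.
Qed.

(** Gauge transformations conjugate the factors of every pairing in the formula
    for the bracket, and keep the diagonals of the moments. *)
Lemma invariants_subalgebra_qbracket :
  invariants_subalgebra q (qbracket (n := n) q r0).
Proof.
move=> phi psi phi_smooth phi_inv psi_smooth psi_inv S L Su.
have S_unit := unitriangular_unit Su.
have E M := qbracket_invariant M phi_smooth phi_inv psi_smooth psi_inv.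
rewrite !E (moment_gauge L phi_smooth phi_inv Su).
rewrite (moment_gauge L psi_smooth psi_inv Su).
rewrite (nabla_gauge L phi_smooth phi_inv Su) (nabla_gauge L psi_smooth psi_inv Su).
rewrite (nabla'_gauge L phi_smooth phi_inv Su) (nabla'_gauge L psi_smooth psi_inv Su).
by rewrite 2!(pairing_conj _ _ S_unit).
Qed.

End Bracket.
End Invariants.

(** * Operators on diagonal matrices *)

Section DiagonalOperators.
Variables (C : numFieldType) (n : nat).
Implicit Types (q c : C) (f g u v w : 'rV[laurent C]_n).

Lemma hpairing_hconst f c :
  hpairing f (hconst n c) = c * residue (\sum_i f 0 i).
Proof.
rewrite hpairingE -residue_lconst_mul mulr_sumr; congr residue.
by apply: eq_bigr => i _; rewrite mxE mulrC.
Qed.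

Lemma hconstD c d : hconst n (c + d) = hconst n c + hconst n d.
Proof. by apply/rowP => i; rewrite !mxE rmorphD. Qed.

Lemma hconstZ c d : hconst n (c * d) = lscale c (hconst n d).
Proof. by apply/rowP => i; rewrite !mxE rmorphM. Qed.

Lemma hconst_lscale c : hconst n c = lscale c (hconst n 1).
Proof. by rewrite -hconstZ mulr1. Qed.

Lemma orth_projP (U : set 'rV[laurent C]_n) f g :
    (forall u v, U u -> U v -> U (u - v)) ->
    (forall u, U u -> orth_compl U u -> u = 0) ->
    U g -> orth_compl U (f - g) ->
  orth_proj U f = g.
Proof.
move=> UB U0 Ug fgU.
have [Up fpU] : U (orth_proj U f) /\ orth_compl U (f - orth_proj U f).
  exact: (@xgetI _ 0 [set g | U g /\ orth_compl U (f - g)] g).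
apply/eqP; rewrite -subr_eq0; apply/eqP/U0; first exact: UB.
move=> u Uu; rewrite (_ : _ - g = (f - g) - (f - orth_proj U f)).
  by rewrite hpairingBl (fgU u Uu) (fpU u Uu) subrr.
by rewrite opprB [RHS]addrC addrA subrK.
Qed.

Lemma hadjoint_rank1 alpha g :
  hadjoint (rank1 alpha) g = lscale (hpairing (hconst n 1) g) alpha.
Proof.
have adj f : hpairing (rank1 alpha f) g =
    hpairing f (lscale (hpairing (hconst n 1) g) alpha).
  by rewrite /rank1 hconst_lscale hpairingZl hpairingZr mulrC.
have := @xgetI _ 0 [set w | forall f, hpairing (rank1 alpha f) g = hpairing f w]
  _ adj; rewrite -/(hadjoint _ _) => /= adj'.
by apply: hpairing_eq => u; rewrite hpairingC -adj' adj hpairingC.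
Qed.

Section Htau.
Variable q : C.
Hypothesis q_neq0 : q != 0.

Lemma htauE f i : htau q f 0 i = dilate q (f 0 (ordS i)).
Proof. by rewrite !mxE. Qed.

Lemma htauD f g : htau q (f + g) = htau q f + htau q g.
Proof. by apply/rowP => i; rewrite !mxE raddfD. Qed.

Lemma htauB f g : htau q (f - g) = htau q f - htau q g.
Proof. by apply/rowP => i; rewrite !mxE raddfB. Qed.

Lemma htauZ c f : htau q (lscale c f) = lscale c (htau q f).
Proof. by apply/rowP => i; rewrite !mxE dilateM// dilate_lconst. Qed.

Lemma htau_hconst c : htau q (hconst n c) = hconst n c.
Proof. by apply/rowP => i; rewrite !mxE dilate_lconst. Qed.

Lemma ordS_inj_n : injective (@ordS n).
Proof. exact: bij_inj (ordS_bij n). Qed.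

(** htau combines a dilation with a permutation of the entries. *)
Lemma hpairing_htau f g : hpairing (htau q f) (htau q g) = hpairing f g.
Proof.
rewrite hpairing_hop// !hpairingE [in RHS](reindex_inj ordS_inj_n)/=.
by congr residue; apply: eq_bigr => i _; rewrite !mxE.
Qed.

Lemma sum_htau f : \sum_i htau q f 0 i = dilate q (\sum_i f 0 i).
Proof.
rewrite [in RHS](reindex_inj ordS_inj_n) raddf_sum /=.
by apply: eq_bigr => i _; rewrite htauE.
Qed.

Lemma hpairing_htau_hconst f c :
  hpairing (htau q f) (hconst n c) = hpairing f (hconst n c).
Proof. by rewrite -[in LHS]htau_hconst hpairing_htau. Qed.

(** U_n consists of the solutions of all but one of the equations of the kernel
    of 1 - htau. *)
Lemma UnP u : Un q u <->
  forall i j : 'I_n, j = i.+1 :> nat -> u 0 i = dilate q (u 0 j).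
Proof.
split=> [[a _ <-] i j ji|u_rec].
  by rewrite !mxE ji dilate_comp exprS invfM mulVKf.
case: (posnP n) => [n0|n_gt0].
  exists 0 => //; apply/rowP => -[i Hi]; exfalso; by rewrite n0 in Hi.
exists (u 0 (Ordinal n_gt0)) => //; apply/rowP => -[i Hi]; rewrite mxE /=.
elim: i Hi => [|i IH] Hi.
  by rewrite expr0 invr1 dilate_id; congr (u 0 _); exact: val_inj.
apply: (can_inj (dilateK q_neq0)); rewrite -(u_rec (Ordinal (ltnW Hi)))//.
by rewrite -IH dilate_comp exprS invfM mulVKf.
Qed.

Lemma Un_row a : Un q (\row_(i < n) dilate (q ^- i) a).
Proof. by exists a. Qed.

Lemma UnB u v : Un q u -> Un q v -> Un q (u - v).
Proof.
by move=> [a _ <-] [b _ <-]; exists (a - b) => //; apply/rowP => i;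
  rewrite !mxE raddfB.
Qed.

Lemma UnZ c u : Un q u -> Un q (lscale c u).
Proof.
move=> [a _ <-]; exists (lconst c * a) => //; apply/rowP => i.
by rewrite !mxE dilateM ?invr_neq0 ?expf_neq0// dilate_lconst.
Qed.

Lemma Un_hconst c : Un q (hconst n c).
Proof.
by exists (lconst c) => //; apply/rowP => i; rewrite !mxE dilate_lconst.
Qed.

Lemma hpairing_Un f a : hpairing f (\row_i dilate (q ^- i) a) =
  residue ((\sum_(i < n) dilate (q ^+ i) (f 0 i)) * a).
Proof.
rewrite hpairingE mulr_suml !raddf_sum; apply: eq_bigr => i _ /=.
by rewrite mxE residue_dilateM ?invr_neq0 ?expf_neq0// invrK.
Qed.

Hypothesis n_gt0 : (0 < n)%N.

Let nR_neq0 : n%:R != 0 :> C.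
Proof. by rewrite pnatr_eq0 -lt0n. Qed.

Lemma sum_dilate_Un a :
  \sum_(i < n) dilate (q ^+ i) ((\row_(i < n) dilate (q ^- i) a) 0 i) =
  lconst n%:R * a.
Proof.
rewrite (eq_bigr (fun=> a)); last first.
  by move=> i _; rewrite mxE dilate_comp mulfV ?expf_neq0// dilate_id.
by rewrite sumr_const card_ord rmorph_nat mulr_natl.
Qed.

Lemma Un_nondegenerate u : Un q u -> orth_compl (Un q) u -> u = 0.
Proof.
move=> [a _ <-] u_perp; suff -> : a = 0.
  by apply/rowP => i; rewrite !mxE raddf0.
suff : lconst n%:R * a = 0.
  by move=> /eqP; rewrite mulf_eq0 rmorph_nat -(rmorph_nat (@lconst C)) 
    fmorph_eq0 (negPf nR_neq0) => /eqP.
apply: residue_mul_eq0 => b; rewrite mulrC -sum_dilate_Un -hpairing_Un.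
exact/u_perp/Un_row.
Qed.

Lemma orth_proj_UnP f :
  Un q (orth_proj (Un q) f) /\ orth_compl (Un q) (f - orth_proj (Un q) f).
Proof.
pose g := \row_(i < n) dilate (q ^- i)
  (lconst n%:R^-1 * \sum_(j < n) dilate (q ^+ j) (f 0 j)).
have fg : orth_compl (Un q) (f - g).
  move=> u [a _ <-]; rewrite hpairingBl !hpairing_Un sum_dilate_Un.
  by rewrite mulrA -rmorphM mulfV// rmorph1 mul1r subrr.
by rewrite (orth_projP UnB Un_nondegenerate (Un_row _) fg); split=> //; exact: Un_row.
Qed.

Lemma orth_proj_UnE f g : Un q g -> orth_compl (Un q) (f - g) ->
  orth_proj (Un q) f = g.
Proof. exact: (orth_projP UnB Un_nondegenerate). Qed.

Lemma residue_sum_hconst c : residue (\sum_i hconst n c 0 i) = n%:R * c.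
Proof.
rewrite (eq_bigr (fun=> lconst c)) => [|i _]; last by rewrite mxE.
by rewrite sumr_const card_ord raddfMn /= /residue /= mulr_natl.
Qed.

Lemma P00E f : P00 f = hconst n (n%:R^-1 * residue (\sum_i f 0 i)).
Proof.
apply: orth_projP.
- by move=> _ _ [c _ <-] [d _ <-]; exists (c - d) => //; apply/rowP => i;
    rewrite !mxE raddfB.
- move=> _ [c _ <-] c_perp; have := c_perp _ (imageT _ 1).
  rewrite hpairing_hconst mul1r residue_sum_hconst => /eqP.
  rewrite mulf_eq0 (negPf nR_neq0) => /eqP ->.
  by apply/rowP => i; rewrite !mxE raddf0.
- by exists (n%:R^-1 * residue (\sum_i f 0 i)).
move=> _ [c _ <-]; rewrite hpairingBl !hpairing_hconst residue_sum_hconst.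
by rewrite mulVKf// subrr.
Qed.

Lemma hpairing_P0' f : hpairing (P0' f) (hconst n 1) = 0.
Proof.
rewrite hpairingBl P00E [hconst n (_ * _)]hconst_lscale hpairingZl.
by rewrite !hpairing_hconst !mul1r residue_sum_hconst mulr1 mulrAC mulVf// mul1r subrr.
Qed.

Lemma P0'_id f : hpairing f (hconst n 1) = 0 -> P0' f = f.
Proof.
rewrite hpairing_hconst mul1r /P0' P00E => ->; apply/rowP => i.
by rewrite !mxE mulr0 raddf0 subr0.
Qed.

Hypothesis q_inf : forall k : int, k != 0 -> q ^ k != 1.

(** The remaining equation of the kernel of 1 - htau forces an element of U_n
    to be constant; it enters through the sum of the entries. *)
Lemma Un_hconstP u : Un q u -> dilate q (\sum_i u 0 i) = \sum_i u 0 i ->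
  exists c, u = hconst n c.
Proof.
move=> [a _ <-] /(dilate_fixed q_inf); set s := \sum_i _ => sE.
exists (lcoef a 0); suff aE : a = lconst (lcoef a 0).
  by apply/rowP => i; rewrite !mxE [in LHS]aE dilate_lconst.
apply: laurentP => k /=; case: eqP => [->//|/eqP k0].
have sk : lcoef s k = (\sum_(i < n) (q ^ (- k)) ^+ i) * lcoef a k.
  rewrite /s (big_morph (fun b => lcoef b k) (fun b d => erefl) erefl) mulr_suml.
  apply: eq_bigr => i _; rewrite mxE /= !exprnP invr_expz !exprz_exp.
  by rewrite !mulNr [k * _]mulrC.
(* The factor is a geometric sum; it vanishes only if q^(-k) is an n-th root of
   unity. *)
have /eqP := sk; rewrite sE /= (negPf k0) eq_sym mulf_eq0 => /orP[/eqP y0|/eqP//].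
have := subrX1 (q ^ (- k)) n; rewrite y0 mulr0 => /eqP.
rewrite subr_eq0 exprnP exprz_exp; apply/contraTeq => _; apply: q_inf.
by rewrite mulf_neq0 ?oppr_eq0//; lia.
Qed.

Lemma htau_fixed w : htau q w = w -> exists c, w = hconst n c.
Proof.
move=> Tw; apply: Un_hconstP; last by rewrite -sum_htau Tw.
apply/UnP => i j ji; rewrite -[in LHS]Tw htauE; congr (dilate q (w 0 _)).
by apply: val_inj; rewrite /= ji modn_small// -ji.
Qed.

Lemma sub_htau_surj f : hpairing f (hconst n 1) = 0 ->
  exists2 w, hpairing w (hconst n 1) = 0 & w - htau q w = f.
Proof.
rewrite hpairing_hconst mul1r => f0.
pose s := \sum_(i < n) dilate (q ^+ i) (f 0 i).
have /(sub_dilate_surj q_inf n_gt0)[b bE] : residue s = 0.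
  rewrite /s -f0 !raddf_sum; apply: eq_bigr => i _ /=; exact: residue_dilate.
(* Solving the equations for i < n - 1 expresses every entry through the one
   with index 0, and the last one becomes b - dilate (q ^+ n) b = s. *)
pose w := \row_(i < n) dilate (q ^- i)
  (b - \sum_(j < n | (j < i)%N) dilate (q ^+ j) (f 0 j)).
suff wE : w - htau q w = f.
  exists (P0' w); first exact: hpairing_P0'.
  rewrite -wE /P0' htauB P00E htau_hconst.
  by rewrite opprB addrA subrK.
apply/rowP => i; rewrite [LHS]mxE [X in _ + X]mxE htauE !mxE /=.
have sumS : \sum_(j < n | (j < i.+1)%N) dilate (q ^+ j) (f 0 j) =
    dilate (q ^+ i) (f 0 i) + \sum_(j < n | (j < i)%N) dilate (q ^+ j) (f 0 j).
  rewrite (bigD1 i)//=; congr (_ + _); apply: eq_bigl => j.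
  by rewrite ltnS -val_eqE andbC ltn_neqAle.
have qi0 : q ^+ i != 0 by rewrite expf_neq0.
have [i_lt|i_ge] := ltnP i.+1 n.
  rewrite modn_small// sumS dilate_comp exprS invfM mulVKf//.
  rewrite -raddfB /= (_ : _ - _ = dilate (q ^+ i) (f 0 i)); last by ring.
  by rewrite dilate_comp mulVf// dilate_id.
have in1 : i.+1 = n by apply/eqP; rewrite eqn_leq ltn_ord i_ge.
rewrite in1 modnn expr0 invr1 dilate_id [X in dilate q (_ - X)]big_pred0//.
have -> : dilate q (b - 0) = dilate (q ^- i) (dilate (q ^+ n) b).
  have -> : q ^+ n = q ^+ i * q by rewrite -exprSr in1.
  by rewrite subr0 dilate_comp mulKf.
rewrite -raddfB /= addrAC bE.
have -> : s = \sum_(j < n | (j < i.+1)%N) dilate (q ^+ j) (f 0 j).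
  by apply: eq_bigl => j; rewrite in1 ltn_ord.
by rewrite sumS addrK dilate_comp mulVf// dilate_id.
Qed.

End Htau.
End DiagonalOperators.

(** * The Cayley transform of htau *)

Section Cayley.
Variables (C : numFieldType) (n : nat) (q : C).
Hypotheses (q_neq0 : q != 0) (n_gt0 : (0 < n)%N).
Hypothesis q_inf : forall k : int, k != 0 -> q ^ k != 1.
Implicit Types (c : C) (f g u v w : 'rV[laurent C]_n).

Lemma hpairing_hconst2 c d : hpairing (hconst n c) (hconst n d) = n%:R * c * d.
Proof. by rewrite hpairing_hconst residue_sum_hconst mulrC. Qed.

Lemma hconst_eq0 c : hpairing (hconst n c) (hconst n 1) = 0 -> c = 0.
Proof.
rewrite hpairing_hconst2 mulr1 => /eqP.
by rewrite mulf_eq0 pnatr_eq0 gtn_eqF// => /eqP.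
Qed.

Lemma hconst0 : hconst n (0 : C) = 0.
Proof. by apply/rowP => i; rewrite !mxE raddf0. Qed.

Lemma sub_htau_perp1 w : hpairing (w - htau q w) (hconst n 1) = 0.
Proof. by rewrite hpairingBl hpairing_htau_hconst// subrr. Qed.

Lemma hpairing_add_htau_hconst w c : hpairing w (hconst n 1) = 0 ->
  hpairing (w + htau q w) (hconst n c) = 0.
Proof.
move=> w1; rewrite hconst_lscale hpairingZr hpairingDl hpairing_htau_hconst// w1.
by rewrite addr0 mulr0.
Qed.

Lemma inv_1_sub_htauE w : hpairing w (hconst n 1) = 0 ->
  inv_1_sub_htau q (w - htau q w) = w.
Proof.
move=> w1; set g := w - htau q w.
have wP : range (@P0' C n) w /\ w - htau q w = g.
  by split=> //; exists w => //; rewrite P0'_id.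
have := @xgetI _ 0 [set v | range (@P0' C n) v /\ v - htau q v = g] w wP.
rewrite -/(inv_1_sub_htau q g) => -[[x _ <-]].
move: (P0' x) (hpairing_P0' n_gt0 x) => v v1 vE.
have : htau q (v - w) = v - w.
  rewrite htauB; apply/eqP; rewrite subr_eq -addrA [- w + _]addrC -opprB -/g -vE.
  by rewrite opprB [v + _]addrC subrK.
move=> /(htau_fixed q_neq0 n_gt0 q_inf)[c vwE].
apply/eqP; rewrite -subr_eq0 vwE; have /hconst_eq0 -> : 
  hpairing (hconst n c) (hconst n 1) = 0 by rewrite -vwE hpairingBl v1 w1 subrr.
by rewrite hconst0.
Qed.

(** The image of 1 - htau is the complement of the constants, so linearity and
    skewness of the Cayley transform can be checked on these sums. *)
Lemma htau_decomposition f :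
  exists c w, hpairing w (hconst n 1) = 0 /\ f = hconst n c + (w - htau q w).
Proof.
have [w w1 wE] := sub_htau_surj q_neq0 n_gt0 q_inf (hpairing_P0' n_gt0 f).
exists (n%:R^-1 * residue (\sum_i f 0 i)), w; split=> //.
by rewrite wE /P0' P00E// addrC subrK.
Qed.

Lemma cayleyE c w : hpairing w (hconst n 1) = 0 ->
  cayley_htau q (hconst n c + (w - htau q w)) = w + htau q w.
Proof.
move=> w1; rewrite /cayley_htau.
suff -> : P0' (hconst n c + (w - htau q w)) = w - htau q w.
  by rewrite inv_1_sub_htauE.
have c_perp : residue (\sum_i (hconst n c + (w - htau q w)) 0 i) = n%:R * c.
  have := hpairing_hconst (hconst n c + (w - htau q w)) 1.
  by rewrite hpairingDl sub_htau_perp1 addr0 hpairing_hconst2 mulr1 mul1r.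
rewrite /P0' P00E// c_perp mulKf ?pnatr_eq0 ?gtn_eqF//.
by rewrite addrAC subrr add0r.
Qed.

Lemma cayley_linear : clinear_on setT (cayley_htau (n := n) q).
Proof.
move=> k u v _ _.
have [c [w [w1 ->]]] := htau_decomposition u.
have [d [x [x1 ->]]] := htau_decomposition v.
have kw1 : hpairing (lscale k w + x) (hconst n 1) = 0.
  by rewrite hpairingDl hpairingZl w1 x1 mulr0 addr0.
rewrite !cayleyE// -[RHS](_ : lscale k w + x + htau q (lscale k w + x) = _).
  rewrite -(cayleyE (k * c + d) kw1); congr cayley_htau.
  rewrite hconstD hconstZ htauD htauZ// lscaleDr lscaleBr -!addrA; congr (_ + _).
  by rewrite opprD; apply/rowP => i; rewrite !mxE; ring.
by rewrite htauD htauZ// lscaleDr addrACA.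
Qed.

(** 1 + htau over 1 - htau is skew because htau preserves the pairing. *)
Lemma cayley_skew f g : hpairing (cayley_htau q f) g = - hpairing f (cayley_htau q g).
Proof.
have [c [w [w1 ->]]] := htau_decomposition f.
have [d [x [x1 ->]]] := htau_decomposition g.
rewrite !cayleyE// [LHS]hpairingDr [in RHS]hpairingDl.
rewrite [hpairing (hconst _ _) _]hpairingC !hpairing_add_htau_hconst// !add0r.
rewrite !(hpairingBl, hpairingBr, hpairingDl, hpairingDr) !hpairing_htau//.
by ring.
Qed.

Lemma cayley_sub_htau w : exists c,
  cayley_htau q (w - htau q w) = w + htau q w - hconst n c.
Proof.
pose d := n%:R^-1 * residue (\sum_i w 0 i); exists (d + d).
have P0'w : P0' w = w - hconst n d by rewrite /P0' P00E.
have -> : w - htau q w = hconst n 0 + (P0' w - htau q (P0' w)).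
  rewrite hconst0 add0r P0'w htauB htau_hconst.
  by apply/rowP => i; rewrite !mxE; ring.
rewrite cayleyE ?hpairing_P0'// P0'w htauB htau_hconst hconstD.
by apply/rowP => i; rewrite !mxE; ring.
Qed.

End Cayley.

(** * Brackets with constraints *)

(** The reduction exists if and only if this operator maps the complement of U_n
    to the constants. *)
Definition deviation (C : numFieldType) (n : nat) (q : C)
    (r0 : 'rV[laurent C]_n -> 'rV[laurent C]_n) (f : 'rV[laurent C]_n) :
    'rV[laurent C]_n :=
  r0 f - lscale 2^-1 (cayley_htau q f).

Section Constraints.
Variables (C : numFieldType) (n : nat) (q : C).
Hypothesis q_neq0 : q != 0.
Implicit Types (phi psi : 'M[laurent C]_n -> C) (L D X Z S : 'M[laurent C]_n).

Lemma YnP L : Yn L <-> forall i j : 'I_n, (j < i)%N -> L i j = (i == j.+1 :> nat)%:R.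
Proof.
split=> [[A Au ->] i j ji|LE]; first by rewrite !mxE Au ?addr0.
exists (L - Lambda_n C n); last by rewrite addrC subrK.
by move=> i j ji; rewrite !mxE LE// subrr.
Qed.

(** Y_n is an affine space directed by the upper triangular matrices, and the
    gradient of a constraint is orthogonal to all of them. *)
Lemma gradient_const_Yn psi L : smooth psi ->
    (exists c, forall L, Yn L -> psi L = c) -> Yn L ->
  forall i j : 'I_n, (j <= i)%N -> gradient psi L i j = 0.
Proof.
move=> psi_smooth [c psi_c] LY i j ji; apply: residue_mul_eq0 => a.
rewrite -pairing_delta; apply: (pairing_gradient_const psi_smooth (c := c)) => t.
apply: psi_c; have [A Au ->] := LY; rewrite -addrA; eexists; last by [].
apply: upper_triangularD => // k l lk; rewrite !mxE.
case: (k =P j) => [kj|_]; last by rewrite !mulr0.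
case: (l =P i) => [li|_]; last by rewrite !mulr0.
by move: lk; rewrite kj li ltnNge ji.
Qed.

(** The gradient is strictly upper triangular, and the only nonzero entries of L
    below the diagonal are the ones of the first subdiagonal. Multiplication by L
    on either side therefore moves the first superdiagonal of the gradient onto
    the diagonal, one step apart for the two sides. *)
Lemma nabla_const_Yn psi L : smooth psi ->
    (exists c, forall L, Yn L -> psi L = c) -> Yn L ->
  [/\ upper_triangular (nabla psi L), upper_triangular (nabla' psi L),
      forall i : 'I_n, i = 0%N :> nat -> nabla psi L i i = 0 &
      forall i : 'I_n, nabla' psi L i i = nabla psi L (ordS i) (ordS i)].
Proof.
move=> psi_smooth psi_c LY.
have D0 := gradient_const_Yn psi_smooth psi_c LY.
have /YnP L0 := LY.
have LD0 (i j k : 'I_n) : (k.+1 < i)%N || (j <= k)%N ->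
    L i k * gradient psi L k j = 0.
  case/orP=> [ki|jk]; last by rewrite D0 ?mulr0.
  by rewrite L0 ?(ltnW ki)// gtn_eqF// mul0r.
have DL0 (i j k : 'I_n) : (k <= i)%N || (j.+1 < k)%N ->
    gradient psi L i k * L k j = 0.
  case/orP=> [ki|jk]; first by rewrite D0 ?mul0r.
  by rewrite L0 ?(ltnW jk)// gtn_eqF// mulr0.
split.
- move=> i j ji; rewrite mxE big1// => k _; apply: LD0.
  by case: leqP => //; lia.
- move=> i j ji; rewrite mxE big1// => k _; apply: DL0.
  by case: leqP => //; lia.
- move=> i i0; rewrite mxE big1// => k _; apply: LD0; lia.
move=> i; rewrite !mxE; have [i_lt|i_ge] := ltnP i.+1 n; last first.
  rewrite !big1// => k _; last by apply: DL0; have := ltn_ord k; lia.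
  apply: LD0; rewrite /=; have -> : i.+1 = n by have := ltn_ord i; lia.
  by rewrite modnn leq0n orbT.
have Si : ordS i = i.+1 :> nat by rewrite /= modn_small.
rewrite (bigD1 (ordS i))//= [RHS](bigD1 i)//= !big1 ?addr0; first last.
- move=> k /eqP ki; have {}ki : nat_of_ord k <> i.+1 by rewrite -Si => /val_inj.
  by apply: DL0; lia.
- move=> k /eqP ki; have {}ki : nat_of_ord k <> i by move=> /val_inj.
  by apply: LD0; rewrite Si; lia.
by rewrite !L0 ?Si// eqxx mulr1 mul1r.
Qed.

(** On Y_n the moment of a constraint is of the form beta - htau beta. Since beta
    starts with 0, this is orthogonal to U_n. *)
Lemma moment_const_Yn psi L : smooth psi ->
    (exists c, forall L, Yn L -> psi L = c) -> Yn L ->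
  let beta := diag_part (hop q^-1 (nabla psi L)) in
  diag_part (nabla' psi L) = htau q beta /\
  diag_part (moment q psi L) = beta - htau q beta.
Proof.
move=> psi_smooth psi_c LY beta.
have [_ _ _ dE] := nabla_const_Yn psi_smooth psi_c LY.
have E : diag_part (nabla' psi L) = htau q beta.
  by apply/rowP => i; rewrite htauE diag_part_hopE dilateVK// diag_partE dE.
by rewrite /moment diag_partB E.
Qed.

Lemma moment_const_Yn_perp psi L : smooth psi ->
    (exists c, forall L, Yn L -> psi L = c) -> Yn L ->
  orth_compl (Un q) (diag_part (moment q psi L)).
Proof.
move=> psi_smooth psi_c LY u /(UnP q_neq0) u_rec.
have [_ ->] := moment_const_Yn psi_smooth psi_c LY; set beta := diag_part _.
have [_ _ b0 _] := nabla_const_Yn psi_smooth psi_c LY.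
rewrite hpairingBl -(hpairing_htau q_neq0 beta u) !hpairingE -raddfB -sumrB /=.
rewrite big1 ?raddf0// => i _; have [i_lt|i_ge] := ltnP i.+1 n.
  by rewrite (u_rec i (ordS i)) ?htauE ?subrr//= modn_small.
rewrite !htauE diag_part_hopE dilateVK// b0 ?mul0r ?subrr//=.
have -> : i.+1 = n by have := ltn_ord i; lia.
by rewrite modnn.
Qed.

Section Bracket.
Hypothesis n_gt0 : (0 < n)%N.
Hypothesis q_inf : forall k : int, k != 0 -> q ^ k != 1.
Variable r0 : 'rV[laurent C]_n -> 'rV[laurent C]_n.
Hypothesis r0_linear : clinear_on setT r0.
Hypothesis r0_skew : skew_on setT r0.
Hypothesis r_hop : forall X, rhat r0 (hop q X) = hop q (rhat r0 X).

(** The bracket with a constraint is governed by the deviation of r0 from the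
    Cayley transform: for beta as above the terms of the bracket without r0 add
    up to the pairing with beta + htau beta, the Cayley transform of
    beta - htau beta up to a constant. *)
Lemma qbracket_constraint phi psi L : smooth phi -> gauge_invariant q phi ->
    smooth psi -> gauge_invariant q psi ->
    (exists c, forall L, Yn L -> psi L = c) -> Yn L ->
  let x := diag_part (moment q phi L) in let y := diag_part (moment q psi L) in
  qbracket q r0 phi psi L =
  - hpairing x (deviation q r0 y).
Proof.
move=> phi_smooth phi_inv psi_smooth psi_inv psi_c LY x y.
have [Bu B'u _ _] := nabla_const_Yn psi_smooth psi_c LY.
have [B'E yE] := moment_const_Yn psi_smooth psi_c LY.
rewrite (qbracket_invariant q_neq0 r0_linear r_hop)// -/x -/y.
rewrite /deviation r0_skew// hpairingBr opprB addrC; congr (_ + _).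
have m_up := moment_upper q_neq0 L phi_smooth phi_inv.
set beta := diag_part (hop q^-1 _) in B'E yE.
have -> : pairing (hop q^-1 (nabla phi L)) (nabla' psi L) =
    hpairing x (htau q beta) + pairing (nabla' phi L) (nabla' psi L).
  by rewrite -B'E -(pairing_upper m_up B'u) -pairingDl subrK.
have -> : pairing (nabla' phi L) (hop q^-1 (nabla psi L)) =
    pairing (nabla phi L) (nabla psi L) - hpairing x beta.
  rewrite -(pairing_upper m_up (upper_triangular_hop q^-1 Bu)) pairingBl.
  by rewrite pairing_hop ?invr_eq0// opprB addrC subrK.
have -> : pairing (nabla' phi L) (nabla' psi L) =
    pairing (nabla phi L) (nabla psi L).
  by rewrite /nabla /nabla' pairing_mulA [RHS]pairing_mulC !mulmxA.
have [c] := cayley_sub_htau q_neq0 n_gt0 q_inf beta; rewrite -yE => ->.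
rewrite hpairingZr hpairingBr hpairingDr hpairing_moment_hconst// subr0.
by congr (_ * _); ring.
Qed.

End Bracket.
End Constraints.

(** * Functionals that are polynomial along lines *)

Section PolynomialLines.
Variable C : numFieldType.
Implicit Types (f g : C -> laurent C) (a b v w : laurent C).

Lemma is_derive_horner0 (p : {poly C}) :
  is_derive (0 : C^o) (1 : C^o) (fun t : C^o => p.[t] : C^o) p`_1.
Proof.
elim/poly_ind: p => [|p c IH].
  rewrite coef0 (_ : (fun t : C^o => _) = cst (0 : C^o)).
    exact: is_derive_cst.
  by apply/funext => t; rewrite horner0.
rewrite coefD coefMX coefC /= addr0.
rewrite (_ : (fun t : C^o => _) =
  ((fun t : C^o => p.[t] : C^o) * id + cst (c : C^o))); last first.
  by apply/funext => t; rewrite !hornerE.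
have := @is_deriveD _ _ _ _ _ _ _ _ _ (is_deriveM IH (is_derive_id (0 : C^o) 1))
  (is_derive_cst (c : C^o) (0 : C^o) (1 : C^o)).
by rewrite addr0 scale0r addr0 -horner_coef0 [_ *: _]mulr1.
Qed.

(** An algebraic form of the statement that the derivative of f at 0 is v. *)
Definition poly_line f v :=
  exists2 P : {poly laurent C}, forall t, f t = P.[lconst t] & P`_1 = v.

Lemma poly_line_unique f v w : poly_line f v -> poly_line f w -> v = w.
Proof.
move=> [P fP <-] [Q fQ <-]; suff -> : P = Q by [].
apply/eqP; rewrite -subr_eq0; apply: contraT => PQ0.
pose s := [seq lconst (i%:R : C) | i <- iota 0 (size (P - Q))].
have s_roots : all (root (P - Q)) s.
  apply/allP => _ /mapP[i _ ->].
  by rewrite rootE hornerD hornerN -fP -fQ subrr.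
have s_uniq : uniq s.
  rewrite map_inj_uniq ?iota_uniq// => i j /lconst_inj/eqP.
  by rewrite eqr_nat => /eqP.
by have := max_poly_roots PQ0 s_roots s_uniq; rewrite size_map size_iota ltnn.
Qed.

Lemma poly_line_affine a b : poly_line (fun t => a + lconst t * b) b.
Proof.
exists (a%:P + 'X * b%:P) => [t|]; first by rewrite !hornerE.
by rewrite coefD coefC coefXM coefC /= add0r.
Qed.

Lemma poly_line_const a : poly_line (fun=> a) 0.
Proof. by exists a%:P => [t|]; rewrite ?hornerC ?coefC. Qed.

Lemma poly_lineD f g v w :
  poly_line f v -> poly_line g w -> poly_line (fun t => f t + g t) (v + w).
Proof.
move=> [P fP <-] [Q gQ <-]; exists (P + Q) => [t|]; last by rewrite coefD.
by rewrite fP gQ hornerD.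
Qed.

Lemma poly_lineM f g v w : poly_line f v -> poly_line g w ->
  poly_line (fun t => f t * g t) (f 0 * w + v * g 0).
Proof.
move=> [P fP <-] [Q gQ <-]; exists (P * Q) => [t|].
  by rewrite fP gQ hornerM.
by rewrite coefM big_ord_recl big_ord1 /= fP gQ rmorph0 !horner_coef0.
Qed.

Lemma poly_line_dilate q f v : q != 0 -> poly_line f v ->
  poly_line (fun t => dilate q (f t)) (dilate q v).
Proof.
move=> q0 [P fP <-]; exists (\poly_(i < size P) dilate q P`_i) => [t|].
  rewrite fP horner_coef horner_poly raddf_sum; apply: eq_bigr => i _ /=.
  by rewrite dilateM// -rmorphXn dilate_lconst.
by rewrite coef_poly; case: ltnP => // P1; rewrite nth_default// raddf0.
Qed.

Lemma poly_line_prod (I : Type) (r : seq I) (f : I -> C -> laurent C)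
    (v : I -> laurent C) :
    (forall i, f i 0 = 1) -> (forall i, poly_line (f i) (v i)) ->
  poly_line (fun t => \prod_(i <- r) f i t) (\sum_(i <- r) v i).
Proof.
move=> f0 fv; elim: r => [|i r IH].
  rewrite big_nil (_ : (fun t => _) = fun=> 1); first exact: poly_line_const.
  by apply/funext => t; rewrite big_nil.
rewrite big_cons (_ : (fun t => _) = fun t => f i t * \prod_(j <- r) f j t).
  have r0 : \prod_(j <- r) f j 0 = 1 by rewrite big1.
  by have := poly_lineM (fv i) IH; rewrite f0 r0 mul1r mulr1 addrC.
by apply/funext => t; rewrite big_cons.
Qed.

Lemma poly_line_residue f v a : poly_line f v ->
  is_derive (0 : C^o) (1 : C^o) (fun t : C^o => residue (a * f t) : C^o)
    (residue (a * v)).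
Proof.
move=> [P fP <-].
have E : residue (a * P`_1) = (\poly_(i < size P) residue (a * P`_i))`_1.
  by rewrite coef_poly; case: ltnP => // P1; rewrite nth_default// mulr0 raddf0.
rewrite E (_ : (fun t : C^o => _) =
  (fun t : C^o => (\poly_(i < size P) residue (a * P`_i)).[t] : C^o)).
  exact: is_derive_horner0.
apply/funext => t; rewrite fP horner_coef horner_poly mulr_sumr raddf_sum.
apply: eq_bigr => i _ /=.
by rewrite mulrA -rmorphXn [in LHS]mulrC residue_lconst_mul mulrC.
Qed.

End PolynomialLines.

Section SmoothSeries.
Variables (C : numFieldType) (n : nat).
Implicit Types (F G : 'M[laurent C]_n -> laurent C) (L X : 'M[laurent C]_n).

(** The second clause says that the functionals residue (a F) have gradients. It
    passes from F to its dilations because the adjoint of a dilation is again a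
    dilation. *)
Definition line_differential F L (dF : 'M[laurent C]_n -> laurent C) :=
  (forall X, poly_line (fun t => F (L + lscale t X)) (dF X)) /\
  (forall a, exists D, forall X, residue (a * dF X) = pairing D X).

Definition series_smooth F := forall L, exists dF, line_differential F L dF.

Lemma lscale0 m (X : 'M[laurent C]_(m, n)) : lscale 0 X = 0.
Proof. by rewrite /lscale rmorph0 scale0r. Qed.

Lemma series_smooth_const a : series_smooth (fun=> a).
Proof.
move=> L; exists (fun=> 0); split=> [X|b]; first exact: poly_line_const.
by exists 0 => X; rewrite mulr0 /pairing mul0mx !raddf0.
Qed.

Lemma series_smooth_entry i j : series_smooth (fun L => L i j).
Proof.
move=> L; exists (fun X => X i j); split=> [X|a].
  rewrite (_ : (fun t => _) = fun t => L i j + lconst t * X i j).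
    exact: poly_line_affine.
  by apply/funext => t; rewrite !mxE.
by exists (a *: delta_mx j i) => X; rewrite pairingC pairing_delta.
Qed.

Lemma series_smoothD F G : series_smooth F -> series_smooth G ->
  series_smooth (fun L => F L + G L).
Proof.
move=> Fs Gs L; have [dF [FdF FD]] := Fs L; have [dG [GdG GD]] := Gs L.
exists (fun X => dF X + dG X); split=> [X|a]; first exact: poly_lineD.
have [D DE] := FD a; have [E EE] := GD a; exists (D + E) => X.
by rewrite mulrDr raddfD /= DE EE pairingDl.
Qed.

Lemma series_smoothM F G : series_smooth F -> series_smooth G ->
  series_smooth (fun L => F L * G L).
Proof.
move=> Fs Gs L; have [dF [FdF FD]] := Fs L; have [dG [GdG GD]] := Gs L.
exists (fun X => F L * dG X + dF X * G L); split=> [X|a].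
  by have := poly_lineM (FdF X) (GdG X); rewrite lscale0 addr0.
have [D DE] := FD (a * G L); have [E EE] := GD (a * F L); exists (E + D) => X.
rewrite pairingDl -DE -EE -raddfD /=; congr residue; ring.
Qed.

Lemma series_smooth_dilate q F : q != 0 -> series_smooth F ->
  series_smooth (fun L => dilate q (F L)).
Proof.
move=> q0 Fs L; have [dF [FdF FD]] := Fs L.
exists (fun X => dilate q (dF X)); split=> [X|a].
  exact: poly_line_dilate.
have [D DE] := FD (dilate q^-1 a); exists D => X.
by rewrite residue_dilateM.
Qed.

Lemma series_smooth_sum (I : Type) (r : seq I) (F : I -> 'M[laurent C]_n -> laurent C) :
  (forall i, series_smooth (F i)) -> series_smooth (fun L => \sum_(i <- r) F i L).
Proof.
move=> Fs; elim: r => [|i r IH].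
  rewrite (_ : (fun L => _) = fun=> 0); first exact: series_smooth_const.
  by apply/funext => L; rewrite big_nil.
rewrite (_ : (fun L => _) = fun L => F i L + \sum_(j <- r) F j L).
  exact: series_smoothD.
by apply/funext => L; rewrite big_cons.
Qed.

Lemma series_smooth_prod (I : Type) (r : seq I) (F : I -> 'M[laurent C]_n -> laurent C) :
  (forall i, series_smooth (F i)) -> series_smooth (fun L => \prod_(i <- r) F i L).
Proof.
move=> Fs; elim: r => [|i r IH].
  rewrite (_ : (fun L => _) = fun=> 1); first exact: series_smooth_const.
  by apply/funext => L; rewrite big_nil.
rewrite (_ : (fun L => _) = fun L => F i L * \prod_(j <- r) F j L).
  exact: series_smoothM.
by apply/funext => L; rewrite big_cons.
Qed.

Lemma series_smooth_det m (A : 'M[laurent C]_n -> 'M[laurent C]_m) :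
    (forall i j, series_smooth (fun L => A L i j)) ->
  series_smooth (fun L => \det (A L)).
Proof.
move=> As; apply: series_smooth_sum => s; apply: series_smoothM.
  exact: series_smooth_const.
exact: series_smooth_prod.
Qed.

Lemma residue_gradient F L dF a : line_differential F L dF ->
  exists2 D, is_gradient (fun L => residue (a * F L)) L D &
    forall X, pairing D X = residue (a * dF X).
Proof.
move=> [FdF FD]; have [D DE] := FD a; exists D => // X.
by rewrite -DE; exact: poly_line_residue.
Qed.

Lemma smooth_residue F a : series_smooth F ->
  smooth (fun L => residue (a * F L)).
Proof.
by move=> Fs L; have [dF /(residue_gradient a)[D FD _]] := Fs L; exists D.
Qed.

End SmoothSeries.

(** * Semi-invariants and their moments *)

Section CyclicMatrix.
Variables (C : numFieldType) (n : nat).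

(** At a point where the determinant vanishes the moments of residue (a det) are
    0; this one is a point of Y_n with determinant 1 or -1. *)
Definition cyclic_mx : 'M[laurent C]_n := \matrix_(i, j) (i == ordS j)%:R.

Lemma cyclic_mx_Yn : Yn cyclic_mx.
Proof.
apply/YnP => i j ji; rewrite mxE -val_eqE /= modn_small//.
by have := ltn_ord i; lia.
Qed.

Lemma det_cyclic_mx : \det cyclic_mx != 0.
Proof.
have -> : cyclic_mx = (perm_mx (perm (@ordS_inj_n n)))^T.
  by apply/matrixP => i j; rewrite !mxE permE eq_sym.
by rewrite det_tr det_perm signr_eq0.
Qed.

End CyclicMatrix.

Section SemiInvariants.
Variables (C : numFieldType) (n : nat) (q : C).
Hypothesis q_neq0 : q != 0.
Implicit Types (F : 'M[laurent C]_n -> laurent C) (L M S : 'M[laurent C]_n).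
Implicit Types (u : 'rV[laurent C]_n) (e : 'I_n -> nat) (b : 'I_n -> 'I_n).

(** Covariance of F under the gauge action of all upper triangular matrices,
    with a character made of dilated diagonal entries. The matrix M stands for
    L S^-1, which keeps the identity polynomial in S. *)
Definition semi_invariant e b F := forall S M, upper_triangular S ->
  F (hop q S *m M) * \prod_i S i i =
  \prod_i dilate (q ^+ e i) (S (b i) (b i)) * F (M *m S).

Lemma semi_invariant_gauge e b F a : semi_invariant e b F ->
  gauge_invariant q (fun L => residue (a * F L)).
Proof.
move=> F_semi S L Su; congr (residue (a * _)).
have := F_semi S (L *m invmx S) (unitriangular_upper Su).
rewrite (mulmxKV (unitriangular_unit Su)) mulmxA -/(gauge q S L).
by rewrite !big1 ?mulr1 ?mul1r// => i _; rewrite (unitriangular_diag _ Su) ?dilate1.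
Qed.

(** The moment of a semi-invariant is the derivative of its character along the
    diagonal matrices. *)
Lemma semi_invariant_moment e b F a L u : series_smooth F ->
    semi_invariant e b F ->
  hpairing (diag_part (moment q (fun L => residue (a * F L)) L)) u =
  residue (a * F L *
    (\sum_i dilate (q ^+ e i) (u 0 (b i)) - \sum_i u 0 i)).
Proof.
move=> Fs F_semi; have [dF FdF] := Fs L.
have [D FD DE] := residue_gradient a FdF; have [FdF' _] := FdF.
rewrite hpairing_moment// (gradientE FD) pairingBr !DE -raddfB -mulrBr -mulrA /=.
congr (residue (a * _)).
have qe0 i : q ^+ e i != 0 by rewrite expf_neq0.
pose S t : 'M[laurent C]_n := 1%:M + lscale t (diag_mx u).
have Sii t i : S t i i = 1 + lconst t * u 0 i.
  by rewrite !mxE eqxx.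
have S_up t : upper_triangular (S t).
  move=> i j ji; rewrite !mxE -val_eqE gtn_eqF// mulr0n.
  by rewrite mulr0 add0r.
have hS t : L + lscale t (hop q (diag_mx u) *m L) = hop q (S t) *m L.
  by rewrite /S hopD hop1 hopZ// mulmxDl mul1mx /lscale -scalemxAl.
have LS t : L + lscale t (L *m diag_mx u) = L *m S t.
  by rewrite /S mulmxDr mulmx1 /lscale -scalemxAr.
have lhs : poly_line
    (fun t => F (L + lscale t (hop q (diag_mx u) *m L)) * \prod_i S t i i)
    (F L * (\sum_i u 0 i) + dF (hop q (diag_mx u) *m L)).
  have prodS : poly_line (fun t => \prod_i S t i i) (\sum_i u 0 i).
    apply: (@poly_line_prod _ _ _ (fun i t => S t i i)) => i.
      by rewrite Sii rmorph0 mul0r addr0.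
    rewrite (_ : (fun t => _) = fun t => 1 + lconst t * u 0 i).
      exact: poly_line_affine.
    by apply/funext => t; rewrite Sii.
  have S0 : \prod_i S 0 i i = 1.
    by rewrite big1// => i _; rewrite Sii rmorph0 mul0r addr0.
  have := poly_lineM (FdF' (hop q (diag_mx u) *m L)) prodS.
  by rewrite lscale0 addr0 S0 mulr1.
have rhs : poly_line
    (fun t => \prod_i dilate (q ^+ e i) (S t (b i) (b i)) *
              F (L + lscale t (L *m diag_mx u)))
    (dF (L *m diag_mx u) + (\sum_i dilate (q ^+ e i) (u 0 (b i))) * F L).
  have prodS : poly_line
      (fun t => \prod_i dilate (q ^+ e i) (S t (b i) (b i)))
      (\sum_i dilate (q ^+ e i) (u 0 (b i))).
    apply: (@poly_line_prod _ _ _ (fun i t => dilate (q ^+ e i) (S t (b i) (b i)))) => i.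
      by rewrite Sii rmorph0 mul0r addr0 dilate1.
    apply: poly_line_dilate => //.
    rewrite (_ : (fun t => _) = fun t => 1 + lconst t * u 0 (b i)).
      exact: poly_line_affine.
    by apply/funext => t; rewrite Sii.
  have S0 : \prod_i dilate (q ^+ e i) (S 0 (b i) (b i)) = 1.
    by rewrite big1// => i _; rewrite Sii rmorph0 mul0r addr0 dilate1.
  have := poly_lineM prodS (FdF' (L *m diag_mx u)).
  by rewrite lscale0 addr0 S0 mul1r.
have := @poly_line_unique _ (fun t => _) _ _ lhs.
rewrite (_ : (fun t => _) = (fun t => \prod_i dilate (q ^+ e i) (S t (b i) (b i)) *
              F (L + lscale t (L *m diag_mx u)))); last first.
  by apply/funext => t; rewrite hS LS F_semi.
move=> /(_ _ rhs) E.
rewrite mulrBr [F L * \sum_i dilate _ _]mulrC; apply/eqP.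
by rewrite subr_eq addrAC eq_sym subr_eq addrC -E addrC eqxx.
Qed.

Lemma semi_invariant_det : semi_invariant (fun=> 1%N) id (@determinant _ n).
Proof.
move=> S M Su; rewrite !det_mulmx [\det S](det_upper Su).
rewrite (det_upper (upper_triangular_hop q Su)).
under [in RHS]eq_bigr do rewrite expr1.
under [in LHS]eq_bigr do rewrite mxE.
by rewrite mulrA.
Qed.

(** If L is seen as the operator h^-1 L on column vectors, this is the matrix of
    its m-th power up to a power of h. *)
Fixpoint twisted_power m L : 'M[laurent C]_n :=
  if m is m'.+1 then hop q (twisted_power m' L) *m L else 1%:M.

(** The factors S cancel between consecutive dilations, as in the gauge
    transformation of a product of operators. *)
Lemma twisted_power_hop m S M :
  twisted_power m (hop q S *m M) *m S =
  hop (q ^+ m) S *m twisted_power m (M *m S).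
Proof.
elim: m => [|m IH] /=.
  rewrite mul1mx mulmx1; apply/matrixP => i j.
  by rewrite mxE expr0 dilate_id.
have hopS : hop (q ^+ m.+1) S = hop q (hop (q ^+ m) S).
  by apply/matrixP => i j; rewrite !mxE dilate_comp exprS.
by rewrite hopS !mulmxA -[in LHS]hopM// IH hopM// !mulmxA.
Qed.

Lemma twisted_power_Yn m L (i j : 'I_n) : Yn L -> (j + m <= i)%N ->
  twisted_power m L i j = (j + m == i)%N%:R.
Proof.
clear q_neq0.
move=> /YnP L0; elim: m j => [|m IH] j; first by rewrite !addn0 mxE eq_sym.
rewrite addnS => jmi; rewrite /= mxE.
have [j1_lt|] := ltnP j.+1 n; last by have := ltn_ord i; lia.
rewrite (bigD1 (Ordinal j1_lt))//= big1 ?addr0; last first.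
  move=> k /eqP kj; have {}kj : nat_of_ord k <> j.+1 by move=> kj'; apply/kj/val_inj.
  have [kj1|j1k] := ltnP k j.+1.
    by rewrite mxE IH 1?ltn_eqF ?raddf0 ?mul0r//; lia.
  by rewrite L0 ?gtn_eqF ?mulr0//; lia.
by rewrite mxE IH ?L0//= ?eqxx ?mulr1 ?dilate_nat ?addSn//; lia.
Qed.

Section FlagMinors.
Variable l : 'I_n.
Hypothesis l_last : l = n.-1 :> nat.

(** The rows of index below d are those of the cyclic sequence that the last
    basis covector generates under twisted powers, the others are basis
    covectors. On Y_n this matrix is upper unitriangular. *)
Definition flag_mx d L : 'M[laurent C]_n := \matrix_(i, j)
  if (i < d)%N then twisted_power (n.-1 - i)%N L l j else (i == j)%:R.

Definition flag_exp d (i : 'I_n) : nat := if (i < d)%N then (n.-1 - i)%N else 0%N.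
Definition flag_index d (i : 'I_n) : 'I_n := if (i < d)%N then l else i.

Lemma flag_mx_hop d S M : upper_triangular S ->
  exists2 N : 'M[laurent C]_n, upper_triangular N &
    (forall i, N i i = dilate (q ^+ flag_exp d i)
                         (S (flag_index d i) (flag_index d i))) /\
    flag_mx d (hop q S *m M) *m S = N *m flag_mx d (M *m S).
Proof.
move=> Su; pose N : 'M[laurent C]_n := \matrix_(i, j)
  if (i < d)%N then if i == j then dilate (q ^+ (n.-1 - i)%N) (S l l) else 0
  else S i j.
exists N; first move=> i j ji.
  rewrite mxE; case: ifP => _; last exact: Su.
  by rewrite -val_eqE gtn_eqF.
split=> [i|].
  rewrite mxE /flag_exp /flag_index; case: ifP => _; first by rewrite eqxx.
  by rewrite expr0 dilate_id.
apply/matrixP => i j; rewrite [LHS]mxE [RHS]mxE; have [id|di] := ltnP i d.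
  transitivity ((twisted_power (n.-1 - i)%N (hop q S *m M) *m S) l j).
    by rewrite mxE; apply: eq_bigr => k _; rewrite mxE id.
  rewrite twisted_power_hop mxE (bigD1 l)//= [in RHS](bigD1 i)//= !big1 ?addr0.
  - by rewrite !mxE id eqxx.
  - by move=> k ki; rewrite !mxE id eq_sym (negPf ki) mul0r.
  move=> k kl; rewrite mxE Su ?raddf0 ?mul0r// l_last.
  have : nat_of_ord k <> n.-1.
    by rewrite -l_last => /val_inj kl'; rewrite kl' eqxx in kl.
  by have := ltn_ord k; lia.
rewrite (bigD1 i)//= big1 ?addr0; last first.
  by move=> k ki; rewrite mxE ltnNge di /= eq_sym (negPf ki) mul0r.
rewrite mxE ltnNge di /= eqxx mul1r (bigD1 j)//= big1 ?addr0.
  rewrite !mxE [(i < d)%N]ltnNge di /=; have [jd|dj] := ltnP j d.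
    by rewrite Su ?mul0r//; exact: leq_trans di.
  by rewrite eqxx mulr1.
move=> k kj; rewrite !mxE [(i < d)%N]ltnNge di /=; have [kd|dk] := ltnP k d.
  by rewrite Su ?mul0r//; exact: leq_trans di.
by rewrite (negPf kj) mulr0.
Qed.

(** The multipliers of the rows are the diagonal entries of an upper triangular
    matrix, so their product is the character. *)
Lemma semi_invariant_flag d :
  semi_invariant (flag_exp d) (flag_index d) (fun L => \det (flag_mx d L)).
Proof.
move=> S M Su; have [N Nu [NE flagE]] := flag_mx_hop d M Su.
rewrite -(det_upper Su) -det_mulmx flagE det_mulmx (det_upper Nu).
by congr (_ * _); apply: eq_bigr.
Qed.

Lemma det_flag_Yn d L : Yn L -> \det (flag_mx d L) = 1.
Proof.
clear q_neq0.
move=> LY; apply: det_unitriangular => i j ji; rewrite mxE.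
case: ifP => // _; rewrite twisted_power_Yn// l_last.
  by congr (_%:R); rewrite -val_eqE /=; have := ltn_ord i; lia.
by have := ltn_ord i; lia.
Qed.

Lemma series_smooth_flag d : series_smooth (fun L => \det (flag_mx d L)).
Proof.
apply: series_smooth_det => i j.
have tp m k r : series_smooth (fun L => twisted_power m L k r).
  elim: m k r => [|m IH] k r; first exact: series_smooth_const.
  rewrite (_ : (fun L => _) =
    fun L => \sum_s dilate q (twisted_power m L k s) * L s r).
    apply: series_smooth_sum => s; apply: series_smoothM.
      exact: series_smooth_dilate.
    exact: series_smooth_entry.
  by apply/funext => L; rewrite /= mxE; apply: eq_bigr => s _; rewrite mxE.
rewrite (_ : (fun L => _) = fun L =>
  if (i < d)%N then twisted_power (n.-1 - i)%N L l j else (i == j)%:R).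
  by case: (i < d)%N; [exact: tp|exact: series_smooth_const].
by apply/funext => L; rewrite mxE.
Qed.

(** The character of the minor of index d compares the first d entries of u with
    those of the element of U_n that has the same last entry; consecutive values
    of d isolate a single entry. *)
Lemma flag_moments_perp L u : Yn L ->
    (forall d a, hpairing
       (diag_part (moment q (fun L => residue (a * \det (flag_mx d L))) L)) u = 0) ->
  Un q u.
Proof.
move=> LY u_perp; pose v (i : 'I_n) := dilate (q ^+ (n.-1 - i)%N) (u 0 l) - u 0 i.
have sumv d : \sum_(i < n | (i < d)%N) v i = 0.
  apply: residue_mul_eq0 => a; rewrite -[RHS](u_perp d a).
  rewrite (semi_invariant_moment a L u (series_smooth_flag d) (@semi_invariant_flag d)).
  rewrite det_flag_Yn// mulr1 -sumrB; congr (residue (a * _)).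
  rewrite [LHS]big_mkcond /=; apply: eq_bigr => i _.
  rewrite /flag_exp /flag_index /v; case: ifP => // _.
  by rewrite expr0 dilate_id subrr.
have v0 i : v i = 0.
  have := sumv i.+1; rewrite (bigD1 i)//= (eq_bigl (fun j : 'I_n => (j < i)%N)).
    by rewrite sumv addr0.
  by move=> j; rewrite ltnS -val_eqE andbC ltn_neqAle.
have uE i : u 0 i = dilate (q ^+ (n.-1 - i)%N) (u 0 l).
  by apply/eqP; rewrite eq_sym -subr_eq0; apply/eqP/v0.
apply/(UnP q_neq0) => i j ji; rewrite uE [in RHS]uE dilate_comp -exprS.
by congr (dilate (q ^+ _) _); have := ltn_ord j; lia.
Qed.

End FlagMinors.

Lemma det_moments_perp u :
    (forall a, hpairing
      (diag_part (moment q (fun L => residue (a * \det L)) (cyclic_mx C n))) u = 0) ->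
  dilate q (\sum_i u 0 i) = \sum_i u 0 i.
Proof.
move=> u_perp; apply/eqP; rewrite -subr_eq0; apply/eqP/residue_mul_eq0 => a.
have := u_perp (a / \det (cyclic_mx C n)).
have dets : series_smooth (@determinant (laurent C) n).
  by apply: series_smooth_det => i j; exact: series_smooth_entry.
rewrite (semi_invariant_moment _ _ _ dets semi_invariant_det).
rewrite (divfK (det_cyclic_mx C n)) => <-; rewrite raddf_sum /=.
by congr (residue (a * (_ - _))); apply: eq_bigr => i _; rewrite expr1.
Qed.

End SemiInvariants.

(** * Skew operators mapping the complement of the constants to U_n *)

Section SkewOperators.
Variables (C : numFieldType) (n : nat) (q : C).
Hypotheses (q_neq0 : q != 0) (n_gt0 : (0 < n)%N).
Implicit Types (f g u v w : 'rV[laurent C]_n).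

Local Notation P := (@orth_proj C n (Un q)).

Lemma orth_proj_Un_linear : clinear_on setT P.
Proof.
move=> c u v _ _; have [Pu uPu] := orth_proj_UnP q_neq0 n_gt0 u.
have [Pv vPv] := orth_proj_UnP q_neq0 n_gt0 v.
have ZB w x : lscale c w + x = x - lscale (- c) w.
  by rewrite /lscale rmorphN scaleNr opprK addrC.
apply: orth_proj_UnE => //; first by rewrite ZB; apply: UnB => //; exact: UnZ.
move=> w Uw; rewrite opprD addrACA -lscaleBr.
move: (u - P u) (v - P v) (uPu w Uw) (vPv w Uw) => x y x0 y0.
by rewrite hpairingDl hpairingZl x0 y0 mulr0 addr0.
Qed.

Lemma orth_proj_Un_id u : Un q u -> P u = u.
Proof.
move=> Uu; apply: orth_proj_UnE => // v _.
by rewrite subrr hpairing0l.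
Qed.

Lemma orth_proj_Un_perp u : orth_compl (Un q) u -> P u = 0.
Proof.
move=> u_perp; apply: orth_proj_UnE => //; last by rewrite subr0.
by rewrite -(hconst0 C n); exact: Un_hconst.
Qed.

Section Form.
Variable E : 'rV[laurent C]_n -> 'rV[laurent C]_n.
Hypothesis E_linear : clinear_on setT E.
Hypothesis E_skew : forall f g, hpairing (E f) g = - hpairing f (E g).
Hypothesis E_Un : forall g, hpairing g (hconst n 1) = 0 -> Un q (E g).

(** By skewness E f is orthogonal to everything that is orthogonal to 1. *)
Lemma skew_Un_const f : orth_compl (Un q) f -> exists c, E f = hconst n c.
Proof.
move=> f_perp.
have Ef_perp g : hpairing g (hconst n 1) = 0 -> hpairing (E f) g = 0.
  by move=> g1; rewrite E_skew f_perp ?oppr0//; exact: E_Un.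
have [c cE] : exists c, P00 (E f) = hconst n c by eexists; exact: P00E.
exists c; apply/eqP; rewrite -subr_eq0 -cE; apply/eqP/hpairing_eq0 => g.
rewrite -/(P0' _); have -> : g = P0' g + P00 g by rewrite subrK.
rewrite hpairingDr [P00 g]P00E// [hconst n (_ * _)]hconst_lscale hpairingZr.
rewrite hpairing_P0'// mulr0 addr0 hpairingBl Ef_perp ?hpairing_P0'//.
by rewrite cE hconst_lscale hpairingZl hpairingC hpairing_P0'// mulr0 subrr.
Qed.

(** Delta is the compression of E to U_n, and alpha is read off from the image
    of the constants: the component of E f outside U_n only depends on the
    component of f along the constants, and skewness relates the two rank one
    terms. *)
Lemma skew_Un_form :
  exists (Delta : 'rV[laurent C]_n -> 'rV[laurent C]_n) (alpha : 'rV[laurent C]_n),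
    [/\ forall u, Un q u -> Un q (Delta u),
        clinear_on (Un q) Delta,
        skew_on (Un q) Delta,
        orth_compl (Un q) alpha &
        forall f, E f = Delta (P f) + rank1 alpha f - hadjoint (rank1 alpha) f].
Proof.
have PU f := (orth_proj_UnP q_neq0 n_gt0 f).1.
have Pperp f := (orth_proj_UnP q_neq0 n_gt0 f).2.
pose e := hconst n n%:R^-1 : 'rV[laurent C]_n.
have e1 : hpairing e (hconst n 1) = 1.
  by rewrite hpairing_hconst2 mulr1 mulfV// pnatr_eq0 -lt0n.
pose alpha : 'rV[laurent C]_n := P (E e) - E e.
have alpha_perp : orth_compl (Un q) alpha.
  move=> u Uu; rewrite /alpha -opprB -[- _]add0r hpairingBl hpairing0l.
  by rewrite Pperp// subrr.
exists (fun u => P (E u)), alpha; split=> //.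
- move=> c u v _ _; rewrite E_linear// orth_proj_Un_linear//.
- move=> u v Uu Uv.
  have -> : hpairing (P (E u)) v = hpairing (E u) v.
    by apply/eqP; rewrite eq_sym -subr_eq0 -hpairingBl Pperp.
  rewrite E_skew; congr (- _); rewrite hpairingC [RHS]hpairingC.
  by apply/eqP; rewrite -subr_eq0 -hpairingBl Pperp.
move=> f; rewrite hadjoint_rank1; set f1 := hpairing _ f.
have fE : f = P f + (f - P f) by rewrite addrC subrK.
have ED u v : E (u + v) = E u + E v.
  by have := @E_linear 1 u v I I; rewrite /lscale rmorph1 !scale1r.
have -> : E f = E (P f) + E (f - P f) by rewrite -ED -fE.
(* The image of the U_n-complement consists of constants; pairing with e
   recovers the constant. *)
have -> : E (f - P f) = rank1 alpha f.
  have [c cE] := skew_Un_const (Pperp f).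
  rewrite cE /rank1; congr hconst.
  have <- : hpairing (hconst n c) e = c.
    by rewrite hpairing_hconst2 mulrAC mulfV ?mul1r// pnatr_eq0 -lt0n.
  rewrite -cE E_skew; transitivity (hpairing (f - P f) alpha).
    by rewrite /alpha hpairingBr (Pperp f _ (PU (E e))) sub0r.
  by rewrite hpairingBl [hpairing (P f) _]hpairingC alpha_perp// subr0.
suff EP : E (P f) = P (E (P f)) - lscale f1 alpha.
  by rewrite [X in X + _]EP addrAC.
have f1E : hpairing (P f) (hconst n 1) = f1.
  apply/eqP; rewrite -subr_eq0 /f1 hpairingC -hpairingBr -opprB.
  by rewrite hpairingC -[- _]sub0r hpairingBl hpairing0l Pperp ?subrr//; exact: Un_hconst.
pose g := P f - lscale f1 e.
have Eg : Un q (E g).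
  by apply: E_Un; rewrite hpairingBl hpairingZl e1 mulr1 f1E subrr.
have PfE : P f = lscale f1 e + g by rewrite addrC subrK.
have EPf : E (P f) = lscale f1 (E e) + E g by rewrite {1}PfE (E_linear f1 I I).
have PEPf : P (E (P f)) = lscale f1 (P (E e)) + E g.
  by rewrite EPf (orth_proj_Un_linear f1 I I) (orth_proj_Un_id Eg).
rewrite PEPf EPf /alpha lscaleBr.
move: (lscale f1 (E e)) (lscale f1 (P (E e))) (E g) => x y z.
by rewrite opprB [y + z]addrC addrA addrAC addrK addrC.
Qed.

End Form.
End SkewOperators.

(** * The reduction theorem *)

Section Reduction.
Variables (C : numFieldType) (n : nat) (q : C).
Hypotheses (q_neq0 : q != 0) (n_gt0 : (0 < n)%N).
Hypothesis q_inf : forall k : int, k != 0 -> q ^ k != 1.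
Variable r0 : 'rV[laurent C]_n -> 'rV[laurent C]_n.
Hypothesis r0_linear : clinear_on setT r0.
Hypothesis r0_skew : skew_on setT r0.
Hypothesis r_hop : forall X, rhat r0 (hop q X) = hop q (rhat r0 X).
Implicit Types (f g u v w : 'rV[laurent C]_n).

(** The projection onto U_n, and the adjoint of the rank one operator, kill the
    moment y of a constraint. What remains of the deviation at y is a constant,
    and constants are orthogonal to all moments. *)
Lemma constraints_ideal_qbracket (Delta : 'rV[laurent C]_n -> 'rV[laurent C]_n)
    (alpha : 'rV[laurent C]_n) :
    clinear_on (Un q) Delta ->
    (forall f, r0 f = lscale 2^-1 (cayley_htau q f) + Delta (orth_proj (Un q) f)
                      + rank1 alpha f - hadjoint (rank1 alpha) f) ->
  constraints_ideal q (qbracket q r0).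
Proof.
move=> Delta_lin r0E phi psi phi_smooth phi_inv psi_smooth psi_inv psi_c L LY.
rewrite (qbracket_constraint q_neq0 n_gt0 q_inf r0_linear r0_skew r_hop phi_smooth
  phi_inv psi_smooth psi_inv psi_c LY).
have y_perp := moment_const_Yn_perp q_neq0 psi_smooth psi_c LY.
set y := diag_part (moment q psi L) in y_perp *.
have U0 : Un q (0 : 'rV[laurent C]_n) by rewrite -(hconst0 C n); exact: Un_hconst.
have Delta0 : Delta 0 = 0.
  have := Delta_lin (-1) 0 0 U0 U0.
  by rewrite /lscale rmorphN1 !scaleN1r oppr0 addr0 addNr.
have y1 : hpairing (hconst n 1) y = 0.
  by rewrite hpairingC; apply: y_perp; exact: Un_hconst.
have -> : deviation q r0 y = rank1 alpha y.
  rewrite /deviation r0E (orth_proj_Un_perp q_neq0 n_gt0 y_perp) Delta0 addr0.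
  rewrite hadjoint_rank1 y1 lscale0.
  move: (lscale _ _) (rank1 alpha y) => a b.
  by rewrite subr0 addrAC subrr add0r.
by rewrite hpairing_moment_hconst// oppr0.
Qed.

Lemma deviation_linear : clinear_on setT (deviation q r0).
Proof.
move=> c u v _ _; rewrite /deviation r0_linear// cayley_linear//.
move: (r0 u) (r0 v) (cayley_htau q u) (cayley_htau q v) => ru rv cu cv.
by apply/rowP => i; rewrite !mxE; ring.
Qed.

Lemma deviation_skew f g :
  hpairing (deviation q r0 f) g = - hpairing f (deviation q r0 g).
Proof.
rewrite hpairingBl hpairingBr r0_skew// hpairingZl hpairingZr cayley_skew//.
by ring.
Qed.

(** The converse evaluates the ideal property on the test functionals at the
    cyclic matrix: the deviation maps the moments of the flag minors to
    constants. Being skew, it then maps the complement of the constants to U_n. *)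
Lemma deviation_Un g : constraints_ideal q (qbracket q r0) ->
  hpairing g (hconst n 1) = 0 -> Un q (deviation q r0 g).
Proof.
move=> ideal g1; have l_lt : (n.-1 < n)%N by rewrite prednK.
pose l := Ordinal l_lt; have l_last : l = n.-1 :> nat by [].
have LY := @cyclic_mx_Yn C n.
have inv_flag d a := semi_invariant_gauge a (semi_invariant_flag q_neq0 l_last d).
have smooth_flag d a := smooth_residue a (series_smooth_flag q_neq0 l d).
have const_flag d a : exists c, forall L, Yn L ->
    residue (a * \det (flag_mx q l d L)) = c.
  exists (residue a) => L.
  by move=> L_Y; rewrite det_flag_Yn// mulr1.
have perp phi d a : smooth phi -> gauge_invariant q phi ->
    hpairing (diag_part (moment q phi (cyclic_mx C n)))
      (deviation q r0 (diag_part (moment q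
        (fun L => residue (a * \det (flag_mx q l d L))) (cyclic_mx C n)))) = 0.
  move=> phi_smooth phi_inv; apply/eqP; rewrite -oppr_eq0; apply/eqP.
  rewrite -(qbracket_constraint q_neq0 n_gt0 q_inf r0_linear r0_skew r_hop
    phi_smooth phi_inv (smooth_flag d a) (inv_flag d a) (const_flag d a) LY).
  exact: (ideal _ _ phi_smooth phi_inv (smooth_flag d a) (inv_flag d a)
    (const_flag d a) _ LY).
apply: (flag_moments_perp q_neq0 l_last LY) => d a.
set y := diag_part _; have [c yE] : exists c, deviation q r0 y = hconst n c.
  apply: (Un_hconstP q_neq0 n_gt0 q_inf).
    by apply: (flag_moments_perp q_neq0 l_last LY) => d' b; exact: perp.
  apply: (det_moments_perp q_neq0) => b; apply: perp.
    by apply: smooth_residue; apply: series_smooth_det => i j; exact: series_smooth_entry.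
  exact: (semi_invariant_gauge b (semi_invariant_det (n := n) q)).
apply: oppr_inj; rewrite -deviation_skew yE oppr0 hconst_lscale hpairingZl hpairingC g1.
by rewrite mulr0.
Qed.

End Reduction.

Theorem theorem2p2 (R : realType) (q : R[i]) (hq : 0 < `|q| < 1)
    (n : nat) (hn : (0 < n)%N)
    (r0 : 'rV[laurent R[i]]_n -> 'rV[laurent R[i]]_n)
    (r0_linear : clinear_on setT r0)
    (r0_skew : skew_on setT r0)
    (r_hop : forall X : 'M[laurent R[i]]_n,
       rhat r0 (hop q X) = hop q (rhat r0 X)) :
  admits_qDS_reduction q (qbracket q r0) <->
  exists (Delta : 'rV[laurent R[i]]_n -> 'rV[laurent R[i]]_n)
         (alpha : 'rV[laurent R[i]]_n),
    [/\ forall u, Un q u -> Un q (Delta u),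
        clinear_on (Un q) Delta,
        skew_on (Un q) Delta,
        orth_compl (Un q) alpha &
        forall f : 'rV[laurent R[i]]_n,
          r0 f = lscale 2^-1 (cayley_htau q f) + Delta (orth_proj (Un q) f)
                 + rank1 alpha f - hadjoint (rank1 alpha) f].
Proof.
have [q_gt0 q_lt1] := andP hq.
have q_neq0 : q != 0 by rewrite -normr_gt0.
have q_pow m : q ^+ m.+1 != 1.
  apply/eqP => /(congr1 Num.norm); rewrite normrX normr1 => qm.
  by have := exprn_ilt1 m.+1 (normr_ge0 q) q_lt1; rewrite qm ltxx.
have q_inf (k : int) : k != 0 -> q ^ k != 1.
  case: k => [[|m]|m] // _; first exact: q_pow.
  by rewrite NegzE -invr_expz -exprnP invr_eq1 q_pow.
split=> [[_ ideal]|[Delta [alpha [_ Delta_lin _ _ r0E]]]].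
  have [Delta [alpha [? ? ? ? EE]]] := skew_Un_form q_neq0 hn
    (deviation_linear q_neq0 hn q_inf r0_linear)
    (deviation_skew q_neq0 hn q_inf r0_skew)
    (fun g => deviation_Un q_neq0 hn q_inf r0_linear r0_skew r_hop ideal (g := g)).
  exists Delta, alpha; split=> // f.
  transitivity (lscale 2^-1 (cayley_htau q f) + deviation q r0 f).
    by rewrite /deviation addrC subrK.
  by rewrite EE !addrA.
split; first exact: invariants_subalgebra_qbracket.
exact: constraints_ideal_qbracket Delta_lin r0E.
Qed.
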